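(* For any $n\ge 0$, $$V^*_{n+1}(p,i)=\overline TV^*_n(p,i)=\underline TV^*_n(p,i),\qquad\forall\,p\in\mathcal P(K),\ i\in S.$$ Moreover, setting $V^*_{-1}\equiv0$, one has for every $n\ge0$, $p\in\mathcal P(K)$, $i\in S$ $$V_n^*(p,i)=\sup_{\mu\in\Pi[0]}\inf_{\nu\in\Sigma[0]}T^{\mu,\nu}V^*_{n-1}(p,i),$$ and, if there exist constants $\delta>0$ and $0<\varepsilon<1$ such that $D(\delta|i,a,b)\le1-\varepsilon$ for all $(i,a,b)\in S\times A\times B$, then $V^*(p,i)=\lim_{n\to\infty}V_n^*(p,i)$ for all $p\in\mathcal P(K)$, $i\in S$.
   Context: Model. $K,S,A,B$ are finite nonempty sets (game types, states, actions of Player 1, actions of Player 2). For a finite set $E$, $\mathcal P(E)$ is the set of probability distributions on $E$. $Q(\cdot,\cdot|i,a,b)$ is a semi-Markov kernel on $[0,\infty)\times S$ given $S\times A\times B$: for all $i,j,a,b$, $t\mapsto Q(t,j|i,a,b)$ is nondecreasing, right continuous, nonnegative, with $Q(0,j|i,a,b)=0$; $\sum_{j}Q(t,j|i,a,b)\le 1$ for all $t$; and $\sum_j\lim_{t\to\infty}Q(t,j|i,a,b)=1$. Put $D(t|i,a,b):=\sum_{j\in S}Q(t,j|i,a,b)$. The payoff rate is $c:K\times S\times A\times B\to[0,\infty)$, and $\alpha>0$ is a fixed discount factor. Policies. $\mathcal H_n=(S\times A\times B)^n\times S$ is the set of histories $h_n=(i_0,a_0,b_0,\dots,a_{n-1},b_{n-1},i_n)$.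 $\Pi$ is the set of policies of Player 1, i.e. families $\pi=\{\pi_n^{(k)}:k\in K,n\ge0\}$ of stochastic kernels $\pi_n^{(k)}(\cdot|h_n)\in\mathcal P(A)$, $h_n\in\mathcal H_n$. $\Sigma$ is the set of policies of Player 2, i.e. families $\sigma=\{\sigma_n:n\ge0\}$ of stochastic kernels $\sigma_n(\cdot|h_n)\in\mathcal P(B)$. Probability. On $\Omega=K\times(S\times A\times B\times[0,\infty))^\infty$ with product $\sigma$-algebra, for $\omega=(k,i_0,a_0,b_0,t_1,i_1,a_1,b_1,t_2,\dots)$ put $\kappa=k$, $X_n=i_n$, $A_n=a_n$, $B_n=b_n$, $T_0=0$, $T_{n}=\sum_{m=1}^{n}t_m$, $H_n=(X_0,A_0,B_0,\dots,A_{n-1},B_{n-1},X_n)$, $T_\infty=\lim_nT_n$. For $p\in\mathcal P(K)$, $i\in S$, $\pi\in\Pi$, $\sigma\in\Sigma$, $\mathbb P_{p,i}^{\pi,\sigma}$ (expectation $\mathbb E_{p,i}^{\pi,\sigma}$) is the unique probability measure with $\mathbb P(X_0=i,\kappa=k)=p_k$; $\mathbb P(A_n=a,B_n=b|\kappa,H_n,T_n)=\pi_n^{(\kappa)}(a|H_n)\sigma_n(b|H_n)$; $\mathbb P(T_{n+1}-T_n\le t,X_{n+1}=j|\kappa,H_n,T_n,A_n,B_n)=Q(t,j|X_n,A_n,B_n)$. Values. For $t\in[T_n,T_{n+1})$ the continuous-time processes (subscript $t$) take the values $X_n,A_n,B_n$. $V(p,i,\pi,\sigma)=\mathbb E_{p,i}^{\pi,\sigma}\big[\int_0^{T_\infty}e^{-\alpha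 t}c(\kappa,X_t,A_t,B_t)\,dt\big]$, and $V^*(p,i)$ is the common value of $\sup_{\pi\in\Pi}\inf_{\sigma\in\Sigma}V(p,i,\pi,\sigma)$ and $\inf_{\sigma\in\Sigma}\sup_{\pi\in\Pi}V(p,i,\pi,\sigma)$, which exists under the hypothesis on $D$ in the claim. For $n\ge0$, $V_n(p,i,\pi,\sigma)=\sum_{m=0}^n\mathbb E_{p,i}^{\pi,\sigma}\big[\frac1\alpha(e^{-\alpha T_m}-e^{-\alpha T_{m+1}})c(\kappa,X_m,A_m,B_m)\big]$, and $V_n^*(p,i)$ is the common value $\sup_{\pi}\inf_{\sigma}V_n(p,i,\pi,\sigma)=\inf_{\sigma}\sup_{\pi}V_n(p,i,\pi,\sigma)$ (these are always equal). Operators. $\Pi[0]$ is the set of families $\mu=\{\mu^{(k)}(\cdot|i)\in\mathcal P(A):k\in K,i\in S\}$ and $\Sigma[0]$ the set of families $\nu=\{\nu(\cdot|i)\in\mathcal P(B):i\in S\}$. For $\gamma=\{\gamma^{(k)}\in\mathcal P(A):k\in K\}$, $a\in A$, $p\in\mathcal P(K)$, let $\Lambda_{\gamma,a}(p)\in\mathcal P(K)$ be $\Lambda_{\gamma,a}(p)(k)=\gamma^{(k)}(a)p_k/\sum_{l\in K}\gamma^{(l)}(a)p_l$ (an arbitrary fixed element of $\mathcal P(K)$ if the denominator is $0$; below it is then multiplied by $0$). For $u:\mathcal P(K)\times S\to\mathbb R$, $$T^{\mu,\nu}u(p,i)=\sum_{k\in K}\sum_{a\in A,b\in B}p_k\mu^{(k)}(a|i)\nu(b|i)c(k,i,a,b)\int_0^\infty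 e^{-\alpha t}(1-D(t|i,a,b))\,dt+\sum_{k\in K}\sum_{a\in A,b\in B}p_k\mu^{(k)}(a|i)\nu(b|i)\sum_{j\in S}\int_0^\infty e^{-\alpha t}Q(dt,j|i,a,b)\,u(\Lambda_{\mu(\cdot|i),a}(p),j),$$ $\overline Tu(p,i)=\inf_{\nu\in\Sigma[0]}\sup_{\mu\in\Pi[0]}T^{\mu,\nu}u(p,i)$ and $\underline Tu(p,i)=\sup_{\mu\in\Pi[0]}\inf_{\nu\in\Sigma[0]}T^{\mu,\nu}u(p,i)$. *)

(* Defs.v *)
From HB Require Import structures.
From mathcomp Require Import all_boot all_order all_algebra.
From mathcomp Require Import all_classical all_reals all_analysis.
Set Implicit Arguments.
Unset Strict Implicit.
Unset Printing Implicit Defensive.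
Import Order.TTheory GRing.Theory Num.Theory.
Import numFieldNormedType.Exports.
Local Open Scope classical_set_scope.
Local Open Scope ring_scope.

(* Finite nonempty sets: the distinguished point only witnesses nonemptiness. *)
#[short(type="finPointedType")]
HB.structure Definition FinPointed := {T of Finite T & isPointed T}.

Section distributions.
Context {R : realType}.

Record dist (E : finType) := Dist {
  pmf :> {ffun E -> R};
  _ : [forall x, 0 <= pmf x] && (\sum_x pmf x == 1) }.

HB.instance Definition _ (E : finType) := [isSub for @pmf E].

Lemma pmf_ge0 (E : finType) (p : dist E) x : 0 <= p x.
Proof. by case: p => f /= /andP[/forallP]. Qed.

Lemma pmf_sum1 (E : finType) (p : dist E) : \sum_x p x = 1.
Proof. by case: p => f /= /andP[_ /eqP]. Qed.

(* If the denominator vanishes, the quotient below is the zero function (x / 0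
   is 0), which is not a distribution, and insubd returns the default p0;
   otherwise the quotient is a distribution, see posteriorE. *)
Definition posterior (K A : finType) (p0 : dist K) (gamma : K -> dist A)
    (a : A) (p : dist K) : dist K :=
  insubd p0 [ffun k => gamma k a * p k / \sum_l gamma l a * p l].

Lemma posteriorE (K A : finType) (p0 : dist K) (gamma : K -> dist A)
    (a : A) (p : dist K) k : \sum_l gamma l a * p l != 0 ->
  posterior p0 gamma a p k = gamma k a * p k / \sum_l gamma l a * p l.
Proof.
move=> d0; rewrite /posterior -[pmf _]/(val _) insubdK ?ffunE//.
apply/andP; split.
  apply/forallP => x; rewrite ffunE divr_ge0 ?mulr_ge0 ?pmf_ge0//.
  by apply: sumr_ge0 => l _; rewrite mulr_ge0 ?pmf_ge0.
under eq_bigr do rewrite ffunE.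
by rewrite -mulr_suml divff.
Qed.

Lemma posterior0 (K A : finType) (p0 : dist K) (gamma : K -> dist A)
    (a : A) (p : dist K) : \sum_l gamma l a * p l = 0 ->
  posterior p0 gamma a p = p0.
Proof.
move=> d0; rewrite /posterior /insubd insubN//; apply/nandP; right.
under eq_bigr do rewrite ffunE.
by rewrite -mulr_suml d0 invr0 mulr0 eq_sym oner_eq0.
Qed.

End distributions.
Arguments dist : clear implicits.

(* The kernel t |-> Q(t,j|i,a,b), written Q i a b j t, is extended by 0 to
   t < 0 (forced by monotonicity, nonnegativity and Q(0,j|i,a,b) = 0), so that
   Q i a b j is a cumulative function on R. *)
Record semi_markov_kernel (R : realType) (S A B : finType) := SemiMarkovKernel {
  smk :> S -> A -> B -> S -> cumulative R R;
  smk_ge0 : forall i a b j t, 0 <= smk i a b j t;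
  smk_at0 : forall i a b j, smk i a b j 0 = 0;
  smk_sum_le1 : forall i a b t, \sum_j smk i a b j t <= 1;
  smk_sum_lim : forall i a b, \sum_j lim (smk i a b j t @[t --> +oo]) = 1 }.

Section game.
Context {R : realType} {K S A B : finPointedType}.

Definition sojourn_df (Q : semi_markov_kernel R S A B) (t : R) i a b : R :=
  \sum_j Q i a b j t.

Definition hist (n : nat) : Type := (n.-tuple (S * A * B) * S)%type.

Definition policy1 := K -> forall n, hist n -> dist R A.
Definition policy2 := forall n, hist n -> dist R B.

(* The n-th entry of the sequence is (i_n, a_n, b_n, t_(n+1)). *)
Definition path_space : Type := (K * (nat -> S * A * B * {nonneg R}))%type.

HB.instance Definition _ := gen_eqMixin path_space.
HB.instance Definition _ := gen_choiceMixin path_space.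
HB.instance Definition _ := isPointed.Build path_space
  (point, fun=> (point, point, point, 0%:nng)).

Section coordinates.
Implicit Types w : path_space.

Definition kappa w : K := w.1.
Definition state (n : nat) w : S := (w.2 n).1.1.1.
Definition act1 (n : nat) w : A := (w.2 n).1.1.2.
Definition act2 (n : nat) w : B := (w.2 n).1.2.
Definition sojourn (n : nat) w : R := (w.2 n).2%:num.

Definition jump_time (n : nat) w : R := \sum_(m < n) sojourn m w.

Definition history (n : nat) w : hist n :=
  ([tuple (state m w, act1 m w, act2 m w) | m < n], state n w).

Definition jump_limit w : \bar R := limn (fun n => (jump_time n w)%:E).

(* The n such that T_n <= t < T_(n+1); unique, and defined when 0 <= t < T_oo. *)
Definition jump_index (t : R) w : nat :=
  xget 0%N [set n | jump_time n w <= t < jump_time n.+1 w].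

Definition gen_by {T : Type} (f : path_space -> T) (G : set (set T)) :=
  preimage_set_system setT f G.

Definition coordinate_sets : set (set path_space) :=
  gen_by kappa discrete_measurable `|`
  \bigcup_n (gen_by (state n) discrete_measurable `|`
             gen_by (act1 n) discrete_measurable `|`
             gen_by (act2 n) discrete_measurable `|`
             gen_by (sojourn n) measurable).

Definition sigma_before (n : nat) : set (set path_space) :=
  <<s gen_by kappa discrete_measurable `|`
      gen_by (@history n) discrete_measurable `|`
      gen_by (jump_time n) measurable >>.

Definition sigma_after (n : nat) : set (set path_space) :=
  <<s gen_by kappa discrete_measurable `|`
      gen_by (@history n) discrete_measurable `|`
      gen_by (jump_time n) measurable `|`
      gen_by (act1 n) discrete_measurable `|`
      gen_by (act2 n) discrete_measurable >>.

End coordinates.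

Definition Omega := g_sigma_algebraType coordinate_sets.

(* Y is a version of the conditional probability P(F | G). *)
Definition is_cond_prob (P : probability Omega R) (G : set (set Omega))
    (F : set Omega) (Y : Omega -> R) : Prop :=
  (forall D : set R, measurable D -> G (Y @^-1` D)) /\
  (forall E, G E -> P (E `&` F) = \int[P]_(w in E) (Y w)%:E)%E.

Record is_law (Q : semi_markov_kernel R S A B) (p : dist R K) (i : S)
    (pi : policy1) (sigma : policy2) (P : probability Omega R) : Prop := IsLaw {
  law_init : forall k, P [set w | state 0 w = i /\ kappa w = k] = (p k)%:E;
  law_act : forall n a b,
    is_cond_prob P (sigma_before n) [set w | act1 n w = a /\ act2 n w = b]
      (fun w => pi (kappa w) n (history n w) a * sigma n (history n w) b);
  law_jump : forall n (t : R) j, 0 <= t ->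
    is_cond_prob P (sigma_after n)
      [set w | jump_time n.+1 w - jump_time n w <= t /\ state n.+1 w = j]
      (fun w => Q (state n w) (act1 n w) (act2 n w) j t) }.

Section payoffs.
Variables (c : K -> S -> A -> B -> R) (alpha : R) (P : probability Omega R).

Definition payoff : \bar R :=
  (\int[P]_w \int[lebesgue_measure]_(t in [set t : R | (0 <= t)%R /\
                                            t%:E < jump_limit w])
    (expR (- alpha * t) * c (kappa w) (state (jump_index t w) w)
       (act1 (jump_index t w) w) (act2 (jump_index t w) w))%:E)%E.

Definition payoff_upto (n : nat) : \bar R :=
  (\sum_(m < n.+1) 'E_P[(fun w => alpha^-1 *
      (expR (- alpha * jump_time m w) - expR (- alpha * jump_time m.+1 w)) *
      c (kappa w) (state m w) (act1 m w) (act2 m w))%R])%E.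

End payoffs.

End game.

Arguments policy1 R K S A B : clear implicits.
Arguments policy2 R S A B : clear implicits.
Arguments Omega R K S A B : clear implicits.

Section value.
Context {R : realType} {X Y : Type}.

Definition maxmin (F : X -> Y -> \bar R) : \bar R :=
  ereal_sup (range (fun x => ereal_inf (range (fun y => F x y)))).

Definition minmax (F : X -> Y -> \bar R) : \bar R :=
  ereal_inf (range (fun y => ereal_sup (range (fun x => F x y)))).

Definition is_value (F : X -> Y -> \bar R) (v : R) : Prop :=
  maxmin F = v%:E /\ minmax F = v%:E.

(* The common value of sup inf and inf sup; 0 if there is none. *)
Definition value (F : X -> Y -> \bar R) : R := xget 0 (is_value F).

End value.

Section game_values.
Context {R : realType} {K S A B : finPointedType}.
Variables (c : K -> S -> A -> B -> R) (alpha : R).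
Variable P : dist R K -> S -> policy1 R K S A B -> policy2 R S A B ->
             probability (Omega R K S A B) R.

Definition Vpay p i pi sigma := payoff c alpha (P p i pi sigma).
Definition Vpay_upto n p i pi sigma := payoff_upto c alpha (P p i pi sigma) n.

Definition Vstar p i : R := value (Vpay p i).
Definition Vstar_upto n p i : R := value (Vpay_upto n p i).

(* V^*_(n-1), with V^*_(-1) = 0 *)
Definition Vstar_before n : dist R K -> S -> R :=
  if n is m.+1 then Vstar_upto m else fun _ _ => 0.

End game_values.

Section shapley.
Context {R : realType} {K S A B : finPointedType}.
Variables (Q : semi_markov_kernel R S A B) (c : K -> S -> A -> B -> R).
Variables (alpha : R) (p0 : dist R K).

Definition stage1 := K -> S -> dist R A.
Definition stage2 := S -> dist R B.

Definition shapley_eval (u : dist R K -> S -> R) (p : dist R K) (i : S)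
    (mu : stage1) (nu : stage2) : R :=
  \sum_k \sum_a \sum_b p k * mu k i a * nu i b * c k i a b *
    (\int[lebesgue_measure]_(t in `[0%R, +oo[)
        (expR (- alpha * t) * (1 - sojourn_df Q t i a b))) +
  \sum_k \sum_a \sum_b p k * mu k i a * nu i b *
    \sum_j (\int[lebesgue_stieltjes_measure (Q i a b j)]_(t in `[0%R, +oo[)
               expR (- alpha * t)) *
           u (posterior p0 (mu^~ i) a p) j.

Definition shapley_up u p i : \bar R :=
  minmax (fun mu nu => (shapley_eval u p i mu nu)%:E).
Definition shapley_low u p i : \bar R :=
  maxmin (fun mu nu => (shapley_eval u p i mu nu)%:E).

End shapley.

(* Main.v *)
Require Import Defs.
From mathcomp Require Import all_boot all_order all_algebra.
From mathcomp Require Import all_classical all_reals all_analysis.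
From mathcomp Require Import measurable_realfun ring lra.
Set Implicit Arguments.
Unset Strict Implicit.
Unset Printing Implicit Defensive.
Import Order.TTheory GRing.Theory Num.Theory.
Import numFieldNormedType.Exports.
Local Open Scope classical_set_scope.
Local Open Scope ring_scope.

(** The expected discount [E[exp(-alpha T_n); kappa = k, H_n = h]] is multiplied,
    when the history grows by [(a, b, j)], by
    [pi(a|h) * sigma(b|h) * int exp(-alpha t) Q(dt, j|i, a, b)]: integrate
    [exp(-alpha x) = int_x^oo alpha exp(-alpha s) ds] by Tonelli, so that only the
    conditional probabilities of the events [t <= s] given by the law are needed.
    Hence [V_n] is the payoff of a finite discounted game in which the sojourn
    times no longer appear.

    In that game let [G_N(i)] be the convex set of vectors [phi] (indexed by the
    types) such that Player 2 can keep the payoff of every type [k] below [phi k]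
    for [N] stages from the state [i], and put [u_N(p, i) = inf_(phi in G_N(i)) p . phi].
    Bayes' rule gives [T^(mu, nu) u_N <= p . phi] for [phi] in [G_(N+1)(i)] and the
    corresponding [nu], and a minimax argument between the finitely many maps
    [K -> A] and the plans of Player 2 (a stage action and a vector of [G_N]
    for each continuation) gives [u_(N+1)(p, i) <= sup_mu inf_nu T^(mu, nu) u_N].
    So [u_(N+1)] is both the value of the one-stage game with continuation payoff
    [u_N] and, by induction, the value of the game with [N + 1] stages.  If the
    sojourn times are not too short, the discounted mass decreases geometrically,
    so that [V_n] converges to [V] uniformly in the policies. *)

(** * Distributions on finite sets *)

Section dist_constructions.
Context {R : realType} {E : finType}.

Lemma dist_of (f : E -> R) : (forall x, 0 <= f x) -> \sum_x f x = 1 ->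
  {p : dist R E | forall x, p x = f x}.
Proof.
move=> f0 f1.
have fP : [forall x, 0 <= [ffun x => f x] x] && (\sum_x [ffun x => f x] x == 1).
  apply/andP; split; first by apply/forallP => x; rewrite ffunE.
  by under eq_bigr do rewrite ffunE; rewrite f1.
by exists (Dist fP) => x /=; rewrite ffunE.
Qed.

Definition point_mass (x : E) : dist R E.
Proof.
refine (sval (@dist_of (fun y => (y == x)%:R) _ _)).
- by move=> y; rewrite ler0n.
- by rewrite (bigD1 x)//= eqxx big1 ?addr0// => y /negPf ->.
Defined.

Lemma dist_mix (p q : dist R E) (t : R) : 0 <= t <= 1 ->
  {r : dist R E | forall x, r x = (1 - t) * p x + t * q x}.
Proof.
move=> /andP[t0 t1]; apply: dist_of => [x|].
  by rewrite addr_ge0 ?mulr_ge0 ?Defs.pmf_ge0 ?subr_ge0.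
by rewrite big_split/= -!mulr_sumr !Defs.pmf_sum1 !mulr1 subrK.
Qed.

End dist_constructions.

(** * An approximate minimax theorem for finitely many coordinates *)

Section minimax.
Context {R : realType} {I : finType} {Y : Type}.
Variables (i0 : I) (f : Y -> I -> R) (M v : R).

(** Squared Euclidean distance from the vector [f y] to the orthant of vectors with all coordinates
    at most [v]; as in approachability theory, it is driven to 0. *)
Let excess (y : Y) : R := \sum_i (Num.max 0 (f y i - v)) ^+ 2.

Hypothesis f_convex : forall y y' t, 0 <= t <= 1 ->
  exists y'', forall i, f y'' i <= (1 - t) * f y i + t * f y' i.
Hypothesis f_response : forall l : dist R I,
  exists y, (forall i, `|f y i| <= M) /\ \sum_i l i * f y i <= v.

Let excess_ge0 y : 0 <= excess y.
Proof. by apply: sumr_ge0 => i _; rewrite sqr_ge0. Qed.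

(* Moving from y towards a reply to the weights (f y i - v)^+ kills the
   first-order term of the squared excess. *)
Let excess_step y t : 0 <= t <= 1 -> 0 < excess y ->
  exists y', excess y' <= (1 - t) ^+ 2 * excess y +
                          t ^+ 2 * \sum_(i : I) (M + `|v|) ^+ 2.
Proof.
move=> /[dup] t01 /andP[t0 t1] ex0.
pose d i := Num.max 0 (f y i - v).
have d0 i : 0 <= d i by rewrite /d le_max lexx.
have s0 : 0 < \sum_i d i.
  rewrite lt_neqAle sumr_ge0 ?andbT//; apply/eqP => /esym/psumr_eq0P d00.
  have : excess y = 0.
    by apply: big1 => i _; rewrite -/(d i) d00 ?expr0n.
  by move=> e0; rewrite e0 ltxx in ex0.
have [||l lE] := @dist_of _ _ (fun i => d i / \sum_i d i).
- by move=> i; rewrite divr_ge0// ltW.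
- by rewrite -mulr_suml divff ?gt_eqF.
have [y' [y'M y'v]] := f_response l.
have [y'' y''P] := f_convex y y' t01.
exists y''.
have cross : \sum_i d i * (f y' i - v) <= 0.
  have -> : \sum_i d i * (f y' i - v) =
      (\sum_i d i) * (\sum_i l i * f y' i - v).
    rewrite mulrBr mulr_sumr mulr_suml -sumrB; apply: eq_bigr => i _.
    by rewrite lE; field; rewrite gt_eqF.
  by rewrite pmulr_rle0// subr_le0.
have -> : (1 - t) ^+ 2 * excess y + t ^+ 2 * (\sum_(i : I) (M + `|v|) ^+ 2) =
  \sum_i ((1 - t) ^+ 2 * d i ^+ 2 + t ^+ 2 * (M + `|v|) ^+ 2).
  by rewrite /excess big_split/= -!mulr_sumr.
apply: (@le_trans _ _ (\sum_i ((1 - t) ^+ 2 * d i ^+ 2 +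
    t ^+ 2 * (M + `|v|) ^+ 2 + 2 * t * (1 - t) * (d i * (f y' i - v))))).
  apply: ler_sum => i _.
  have dle : f y i - v <= d i by rewrite /d le_max lexx orbT.
  (* If [f y'' i] exceeds [v], convexity and [f y i - v <= d i] bound the excess by this
     combination, which is then nonnegative; otherwise the left side is 0. *)
  apply: (@le_trans _ _ (((1 - t) * d i + t * (f y' i - v)) ^+ 2)).
    have := y''P i; case: (lerP 0 (f y'' i - v)) => fy Hy.
      rewrite ler_sqr ?nnegrE//; last first.
        by apply: (le_trans fy); nra.
      by nra.
    by rewrite expr0n/= sqr_ge0.
  rewrite [leLHS](_ : _ = (1 - t) ^+ 2 * d i ^+ 2 + t ^+ 2 * (f y' i - v) ^+ 2
     + 2 * t * (1 - t) * (d i * (f y' i - v))); last by ring.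
  rewrite lerD2r lerD2l ler_wpM2l ?sqr_ge0//.
  rewrite -real_normK ?num_real// ler_sqr ?nnegrE//; last first.
    by rewrite addr_ge0// (le_trans _ (y'M i)).
  by rewrite (le_trans (ler_normB _ _))// lerD2r.
rewrite big_split/= -mulr_sumr gerDl.
by rewrite mulr_ge0_le0// mulr_ge0 ?mulr_ge0 ?subr_ge0.
Qed.

Let inf_excess : inf (range excess) <= 0.
Proof.
have [y1 [y1M _]] := f_response (point_mass i0).
have hinf : has_inf (range excess).
  by split; [exists (excess y1); exists y1|exists 0 => _ [z _ <-]].
rewrite leNgt; apply/negP; set phi := inf _ => phi0.
have phile y : phi <= excess y by apply: ge_inf; [exact: hinf.2|exists y].
set L := \sum_(i : I) (M + `|v|) ^+ 2.
have L0 : 0 <= L by apply: sumr_ge0 => i _; rewrite sqr_ge0.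
(* This step size gives [t * (phi + L) <= phi]. From a point within [t * phi / 2] of the infimum,
   one step then reaches an excess of at most [phi - t * phi / 2], below the infimum. *)
pose t := phi / (phi + L + 1).
have den0 : 0 < phi + L + 1 by lra.
have t0 : 0 < t by rewrite divr_gt0.
have tden : t * (phi + L + 1) = phi by rewrite /t divfK ?gt_eqF.
have t1 : t <= 1 by rewrite ler_pdivrMr//; lra.
have e0 : 0 < t * phi / 2 by have := mulr_gt0 t0 phi0; lra.
have [_ [y _ <-] ylt] := inf_adherent e0 hinf.
have [||y' y'le] := @excess_step y t; first by rewrite ltW.
  exact: lt_le_trans (phile y).
have := phile y'; rewrite -/L -/phi in y'le ylt.
have : (1 - t) ^+ 2 * excess y <= (1 - t) ^+ 2 * phi + t * phi / 2.
  apply: (@le_trans _ _ ((1 - t) ^+ 2 * (phi + t * phi / 2))).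
    by rewrite ler_wpM2l ?sqr_ge0// ltW.
  rewrite mulrDr lerD2l ler_piMl ?(ltW e0)//.
  by rewrite expr_le1 ?subr_ge0// lerBlDr lerDl ltW.
have : t ^+ 2 * (phi + L) <= t * phi.
  rewrite expr2 -mulrA ler_wpM2l ?(ltW t0)//; nra.
move: y'le; nra.
Qed.

(** A reply to each weighting [l] of the coordinates yields one [y] that is good for all coordinates
    at once: the excess has infimum 0, and an excess below [e ^+ 2] leaves every coordinate below
    [v + e]. *)
Lemma approx_minimax e : 0 < e -> exists y, forall i, f y i <= v + e.
Proof.
move=> e0; have [y1 _] := f_response (point_mass i0).
have hinf : has_inf (range excess).
  by split; [exists (excess y1); exists y1|exists 0 => _ [z _ <-]].
have [_ [y _ <-] ylt] := inf_adherent (exprn_gt0 2 e0) hinf.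
exists y => i; have {}ylt : excess y < e ^+ 2.
  by rewrite (lt_le_trans ylt)// gerDr.
have : Num.max 0 (f y i - v) ^+ 2 < e ^+ 2.
  apply: le_lt_trans ylt; rewrite /excess (bigD1 i)//= lerDl.
  by apply: sumr_ge0 => j _; rewrite sqr_ge0.
rewrite ltr_sqr ?nnegrE ?le_max ?lexx ?(ltW e0)// gt_max => /andP[_].
by rewrite ltrBlDl => /ltW.
Qed.

End minimax.

(** * The finite discounted game in which sojourn times no longer appear *)

Section finite_game.
Context {R : realType} {K S A B : finPointedType}.
(** To be instantiated by [c] times the expected discounted sojourn and by the Laplace transforms of
    the kernel; the discounting is hidden in the row sums of [q], which may be below 1. *)
Variables (ct : K -> S -> A -> B -> R) (q : S -> A -> B -> S -> R).
Variables (C : R) (p0 : dist R K).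
Hypothesis ct_ge0 : forall k i a b, 0 <= ct k i a b.
Hypothesis ct_le : forall k i a b, ct k i a b <= C.
Hypothesis q_ge0 : forall i a b j, 0 <= q i a b j.
Hypothesis q_le1 : forall i a b, \sum_j q i a b j <= 1.

Let C_ge0 : 0 <= C.
Proof. exact: le_trans (ct_ge0 point point point point) (ct_le _ _ _ _). Qed.

(** The finite game is analysed by removing its first stage, so histories grow at the front here;
    under the law of the process they grow at the end. *)
Definition cons_hist n (x : S * A * B) (h : @hist S A B n) : @hist S A B n.+1 :=
  ([tuple of x :: h.1], h.2).

Definition tail1 (x : S * A * B) (pi : policy1 R K S A B) : policy1 R K S A B :=
  fun k n h => pi k n.+1 (cons_hist x h).

Definition tail2 (x : S * A * B) (sg : policy2 R S A B) : policy2 R S A B :=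
  fun n h => sg n.+1 (cons_hist x h).

Definition glue1 (mu : K -> S -> dist R A)
    (cont : S * A * B -> policy1 R K S A B) : policy1 R K S A B :=
  fun k n => match n return @hist S A B n -> dist R A with
  | 0 => fun h => mu k h.2
  | m.+1 => fun h => cont (thead h.1) k m ([tuple of behead h.1], h.2)
  end.

Definition glue2 (nu : S -> dist R B)
    (cont : S * A * B -> policy2 R S A B) : policy2 R S A B :=
  fun n => match n return @hist S A B n -> dist R B with
  | 0 => fun h => nu h.2
  | m.+1 => fun h => cont (thead h.1) m ([tuple of behead h.1], h.2)
  end.

Lemma behead_cons_hist n x (h : @hist S A B n) :
  ([tuple of behead (cons_hist x h).1], (cons_hist x h).2) = h.
Proof. by case: h => h i; congr pair; exact: val_inj. Qed.

Lemma tail_glue1 mu cont x : tail1 x (glue1 mu cont) = cont x.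
Proof.
apply/funext => k; apply: functional_extensionality_dep => n.
by apply/funext => h; rewrite /tail1 /glue1 behead_cons_hist.
Qed.

Lemma tail_glue2 nu cont x : tail2 x (glue2 nu cont) = cont x.
Proof.
apply: functional_extensionality_dep => n.
by apply/funext => h; rewrite /tail2 /glue2 behead_cons_hist.
Qed.

(** Payoff conditional on the type. Restarting with the tail policies after the first stage keeps
    histories out of the recursion. *)
Fixpoint type_payoff N k (pi : policy1 R K S A B) (sg : policy2 R S A B) i : R :=
  if N is N'.+1 then
    \sum_a \sum_b pi k 0 ([tuple], i) a * sg 0 ([tuple], i) b *
      (ct k i a b + \sum_j q i a b j *
         type_payoff N' k (tail1 (i, a, b) pi) (tail2 (i, a, b) sg) j)
  else 0.

(** The type and the action of Player 1 are fixed. The continuation bounds may depend on [a], [b]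
    and [j], all of which Player 2 observes. *)
Definition vec_payoff i (nu : dist R B) (psi : A -> B -> S -> K -> R) k a : R :=
  \sum_b nu b * (ct k i a b + \sum_j q i a b j * psi a b j k).

(* The vectors of type-dependent payoff bounds that Player 2 can guarantee in N
   stages from state i, truncated to [0, N C]. *)
Fixpoint guaranteed N i (phi : K -> R) : Prop :=
  (forall k, 0 <= phi k <= N%:R * C) /\
  if N is N'.+1 then
    exists (nu : dist R B) (psi : A -> B -> S -> K -> R),
      (forall a b j, guaranteed N' j (psi a b j)) /\
      (forall k a, vec_payoff i nu psi k a <= phi k)
  else True.

Lemma guaranteed_bounds N i phi k : guaranteed N i phi -> 0 <= phi k <= N%:R * C.
Proof. by case: N => [|N] []. Qed.

Lemma vec_payoff_bounds N i nu psi k a :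
  (forall a b j, guaranteed N j (psi a b j)) ->
  0 <= vec_payoff i nu psi k a <= N.+1%:R * C.
Proof.
move=> g; have psi0 a' b j : 0 <= psi a' b j k <= N%:R * C.
  exact: guaranteed_bounds (g a' b j).
apply/andP; split.
  apply: sumr_ge0 => b _; rewrite mulr_ge0 ?Defs.pmf_ge0// addr_ge0//.
  by apply: sumr_ge0 => j _; rewrite mulr_ge0//; case/andP: (psi0 a b j).
set D := N.+1%:R * C; rewrite -[D]mul1r -(Defs.pmf_sum1 nu) mulr_suml.
apply: ler_sum => b _; rewrite ler_wpM2l ?Defs.pmf_ge0// /D -natr1 mulrDl mul1r addrC lerD//.
apply: (@le_trans _ _ (\sum_j q i a b j * (N%:R * C))).
  by apply: ler_sum => j _; rewrite ler_wpM2l//; case/andP: (psi0 a b j).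
by rewrite -mulr_suml ler_piMl// mulr_ge0.
Qed.

Lemma guaranteed_const N i : guaranteed N i (fun=> N%:R * C).
Proof.
elim: N i => [|N IH] i; first by split => // k; rewrite mul0r lexx.
split; first by move=> k; rewrite lexx mulr_ge0.
exists (point_mass point), (fun _ _ _ _ => N%:R * C); split => // k a.
by have /andP[] := @vec_payoff_bounds N i (point_mass point)
  (fun _ _ _ _ => N%:R * C) k a (fun _ _ => IH).
Qed.

(* Mixing two plans: play the mixture of the two stage actions and, after
   action b, mix the continuations with the posterior weight of the second
   plan. If b has probability 0, that weight is 0 (division by 0). *)
Lemma vec_payoff_mix N i nu psi nu' psi' t : 0 <= t <= 1 ->
  (forall i phi phi' t, 0 <= t <= 1 -> guaranteed N i phi ->
    guaranteed N i phi' -> guaranteed N i (fun k => (1 - t) * phi k + t * phi' k)) ->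
  (forall a b j, guaranteed N j (psi a b j)) ->
  (forall a b j, guaranteed N j (psi' a b j)) ->
  exists nu'' psi'', (forall a b j, guaranteed N j (psi'' a b j)) /\
    forall k a, vec_payoff i nu'' psi'' k a =
      (1 - t) * vec_payoff i nu psi k a + t * vec_payoff i nu' psi' k a.
Proof.
move=> /[dup] t01 /andP[t0 t1] cvx g g'.
have [nu'' nuE] := dist_mix nu nu' t01.
pose s b := t * nu' b / nu'' b.
have w0 b : 0 <= (1 - t) * nu b by rewrite mulr_ge0 ?subr_ge0 ?Defs.pmf_ge0.
have w0' b : 0 <= t * nu' b by rewrite mulr_ge0 ?Defs.pmf_ge0.
have sM b : nu'' b * s b = t * nu' b.
  rewrite /s; have [nu0|nu0] := eqVneq (nu'' b) 0; last by rewrite mulrC divfK.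
  rewrite nu0 mul0r; have := nuE b; rewrite nu0; have := w0 b; have := w0' b; lra.
have s01 b : 0 <= s b <= 1.
  rewrite /s; have [->|nu0] := eqVneq (nu'' b) 0; first by rewrite invr0 mulr0 lexx ler01.
  have nup : 0 < nu'' b by rewrite lt_neqAle eq_sym nu0 Defs.pmf_ge0.
  by rewrite divr_ge0 ?(ltW nup)//= ler_pdivrMr// mul1r nuE lerDr.
exists nu'', (fun a b j k => (1 - s b) * psi a b j k + s b * psi' a b j k); split.
  by move=> a b j; apply: cvx.
move=> k a; rewrite /vec_payoff !mulr_sumr -big_split; apply: eq_bigr => b _ /=.
have -> : \sum_j q i a b j * ((1 - s b) * psi a b j k + s b * psi' a b j k) =
   (1 - s b) * (\sum_j q i a b j * psi a b j k) +
   s b * (\sum_j q i a b j * psi' a b j k).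
  by rewrite !mulr_sumr -big_split; apply: eq_bigr => j _ /=; ring.
have : nu'' b * (1 - s b) = (1 - t) * nu b by rewrite mulrBr mulr1 sM nuE; ring.
move: (sM b) (ct k i a b) (\sum_j _) (\sum_j _) => e1 x y z e2.
rewrite !mulrA -e1 -e2; ring.
Qed.

Lemma guaranteed_convex N i phi phi' t : 0 <= t <= 1 -> guaranteed N i phi ->
  guaranteed N i phi' -> guaranteed N i (fun k => (1 - t) * phi k + t * phi' k).
Proof.
have bounds n (x y s : R) : 0 <= s <= 1 -> 0 <= x <= n -> 0 <= y <= n ->
    0 <= (1 - s) * x + s * y <= n.
  move=> /andP[s0 s1] /andP[x0 x1] /andP[y0 y1]; nra.
elim: N i phi phi' t => [|N IH] i phi phi' t t01 [phib g] [phib' g'].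
  by split => // k; exact: bounds.
split; first by move=> k; exact: bounds.
case: g => nu [psi [g le]]; case: g' => nu' [psi' [g' le']].
have [nu'' [psi'' [g'' E]]] := @vec_payoff_mix N i nu psi nu' psi' t t01 IH g g'.
exists nu'', psi''; split => // k a; rewrite E.
by case/andP: t01 => t0 t1; rewrite lerD// ler_wpM2l// subr_ge0.
Qed.

(** * The value as a lower envelope of linear functions of the belief *)

Definition inner (p : dist R K) (phi : K -> R) : R := \sum_k p k * phi k.

Lemma inner_bounds p phi m M : (forall k, m <= phi k <= M) -> m <= inner p phi <= M.
Proof.
move=> phib; rewrite -[m]mul1r -[M]mul1r -(Defs.pmf_sum1 p) !mulr_suml.
by apply/andP; split; apply: ler_sum => k _; rewrite ler_wpM2l ?Defs.pmf_ge0//;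
  case/andP: (phib k).
Qed.

Let inner_guaranteed_ge0 N i p phi : guaranteed N i phi -> 0 <= inner p phi.
Proof.
move=> g; have /andP[] // : 0 <= inner p phi <= N%:R * C.
by apply: inner_bounds => k; exact: guaranteed_bounds g.
Qed.

Definition finite_value N (p : dist R K) i : R :=
  inf [set inner p phi | phi in guaranteed N i].

Let guaranteed_has_inf N p i : has_inf [set inner p phi | phi in guaranteed N i].
Proof.
split; first by exists (inner p (fun=> N%:R * C)), (fun=> N%:R * C) => //;
  exact: guaranteed_const.
by exists 0 => _ [phi g <-]; exact: inner_guaranteed_ge0 g.
Qed.

Lemma finite_value_le N p i phi : guaranteed N i phi -> finite_value N p i <= inner p phi.
Proof.
by move=> g; apply: ge_inf; [exact: (guaranteed_has_inf N p i).2|exists phi].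
Qed.

Lemma finite_value_approx N p i e : 0 < e ->
  exists2 phi, guaranteed N i phi & inner p phi <= finite_value N p i + e.
Proof.
move=> e0; have [_ [phi g <-] lt] := inf_adherent e0 (guaranteed_has_inf N p i).
by exists phi => //; exact: ltW.
Qed.

Lemma finite_value0 : finite_value 0 = fun _ _ => 0.
Proof.
apply/funext => p; apply/funext => i; apply/eqP; rewrite eq_le; apply/andP; split.
  apply: (le_trans (finite_value_le p (guaranteed_const 0 i))).
  by rewrite /inner big1// => k _; rewrite mul0r mulr0.
apply: lb_le_inf; first exact: (guaranteed_has_inf 0 p i).1.
by move=> _ [phi g <-]; exact: inner_guaranteed_ge0 g.
Qed.

(** The continuation [X] may depend on the type, so that the same sum covers vectors guaranteed by
    Player 2, actual payoffs of policies, and values at the posterior. *)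
Definition stage_sum (p : dist R K) i (mu : K -> dist R A) (nu : dist R B)
    (X : A -> B -> S -> K -> R) : R :=
  \sum_k \sum_a \sum_b p k * mu k a * nu b *
    (ct k i a b + \sum_j q i a b j * X a b j k).

Lemma stage_sumE p i mu nu X :
  stage_sum p i mu nu X = \sum_k p k * \sum_a mu k a * vec_payoff i nu X k a.
Proof.
apply: eq_bigr => k _; rewrite mulr_sumr; apply: eq_bigr => a _.
by rewrite mulrA mulr_sumr; apply: eq_bigr => b _; rewrite mulrA.
Qed.

Lemma type_payoff_stage N (p : dist R K) pi sg i :
  \sum_k p k * type_payoff N.+1 k pi sg i =
  stage_sum p i (fun k => pi k 0 ([tuple], i)) (sg 0 ([tuple], i))
    (fun a b j k => type_payoff N k (tail1 (i, a, b) pi) (tail2 (i, a, b) sg) j).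
Proof.
apply: eq_bigr => k _; rewrite mulr_sumr; apply: eq_bigr => a _.
by rewrite mulr_sumr; apply: eq_bigr => b _; rewrite !mulrA.
Qed.

(** If [a] has total probability 0, every term of that vanishing nonnegative sum is 0, so both sides
    are 0 whatever default the posterior takes. *)
Lemma bayes (p : dist R K) (mu : K -> dist R A) a k :
  p k * mu k a = (\sum_l mu l a * p l) * posterior p0 mu a p k.
Proof.
have [s0|s0] := eqVneq (\sum_l mu l a * p l) 0; last first.
  by rewrite posteriorE// mulrC [RHS]mulrC divfK.
rewrite s0 mul0r mulrC; move/eqP: s0; rewrite psumr_eq0.
  by move=> /allP/(_ k); rewrite mem_index_enum => /(_ isT)/eqP.
by move=> l _; rewrite mulr_ge0 ?Defs.pmf_ge0.
Qed.

(** By Bayes' rule, continuation vectors enter the stage sum only through their averages under the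
    posterior. The weights of the pairs of actions add up to 1 and the rows of [q] to at most 1, so
    the error [e] is not amplified. *)
Lemma stage_sum_mono p i mu nu X Y (e : R) : 0 <= e ->
  (forall a b j, inner (posterior p0 mu a p) (X a b j) <=
                 inner (posterior p0 mu a p) (Y a b j) + e) ->
  stage_sum p i mu nu X <= stage_sum p i mu nu Y + e.
Proof.
move=> e0 XY.
have regroup X' : stage_sum p i mu nu X' = \sum_a \sum_b
    (\sum_l mu l a * p l) * nu b * (inner (posterior p0 mu a p) (fun k => ct k i a b) +
      \sum_j q i a b j * inner (posterior p0 mu a p) (X' a b j)).
  rewrite /stage_sum exchange_big; apply: eq_bigr => a _ /=.
  rewrite exchange_big; apply: eq_bigr => b _ /=.
  rewrite (_ : inner _ _ + _ = inner (posterior p0 mu a p)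
      (fun k => ct k i a b + \sum_j q i a b j * X' a b j k)); last first.
    rewrite /inner; under [RHS]eq_bigr do rewrite mulrDr mulr_sumr.
    rewrite big_split/= exchange_big/=; congr (_ + _); apply: eq_bigr => j _.
    by rewrite mulr_sumr; apply: eq_bigr => k _; rewrite mulrCA.
  rewrite mulr_sumr; apply: eq_bigr => k _.
  by rewrite bayes -!mulrA; congr (_ * _); rewrite mulrCA.
have w_ge0 a : 0 <= \sum_l mu l a * p l.
  by apply: sumr_ge0 => l _; rewrite mulr_ge0 ?Defs.pmf_ge0.
have total : \sum_a \sum_b (\sum_l mu l a * p l) * nu b = 1.
  under eq_bigr do rewrite -mulr_sumr Defs.pmf_sum1 mulr1.
  rewrite exchange_big/=; under eq_bigr do rewrite -mulr_suml Defs.pmf_sum1 mul1r.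
  by rewrite Defs.pmf_sum1.
rewrite !regroup -[X in _ <= _ + X]mul1r -total mulr_suml -big_split; apply: ler_sum => a _ /=.
rewrite mulr_suml -big_split; apply: ler_sum => b _ /=.
rewrite -mulrDr ler_wpM2l ?mulr_ge0 ?Defs.pmf_ge0// -addrA lerD2l.
apply: (@le_trans _ _ (\sum_j q i a b j * (inner (posterior p0 mu a p) (Y a b j) + e))).
  by apply: ler_sum => j _; rewrite ler_wpM2l.
under [leLHS]eq_bigr do rewrite mulrDr.
by rewrite big_split/= lerD2l -mulr_suml ler_piMl.
Qed.

Lemma inner_cst p x : inner p (fun=> x) = x.
Proof. by rewrite /inner -mulr_suml Defs.pmf_sum1 mul1r. Qed.

(** Constant in [b] and in the type: the action of Player 2, who does not know the type, reveals
    nothing about it. *)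
Definition belief_value N p (mu : K -> dist R A) : A -> B -> S -> K -> R :=
  fun a _ j _ => finite_value N (posterior p0 mu a p) j.

(** Each [psi a b j] is a candidate in the infimum defining the value at the posterior, so it may
    replace that value; what remains is an average of [vec_payoff] over the actions of Player 1. *)
Lemma stage_sum_guaranteed N p i nu psi phi mu :
  (forall a b j, guaranteed N j (psi a b j)) ->
  (forall k a, vec_payoff i nu psi k a <= phi k) ->
  stage_sum p i mu nu (belief_value N p mu) <= inner p phi.
Proof.
move=> g le; apply: (@le_trans _ _ (stage_sum p i mu nu psi)).
  rewrite -[leRHS]addr0; apply: stage_sum_mono => // a b j.
  by rewrite inner_cst addr0 finite_value_le.
rewrite stage_sumE; apply: ler_sum => k _; rewrite ler_wpM2l ?Defs.pmf_ge0//.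
rewrite -[leRHS]mul1r -(Defs.pmf_sum1 (mu k)) mulr_suml.
by apply: ler_sum => a _; rewrite ler_wpM2l ?Defs.pmf_ge0.
Qed.

(** The minimax theorem is applied with pure maps from types to actions as coordinates and plans of
    Player 2 as points. Half of [e] pays for the choice of continuation vectors, the other half for
    the minimax theorem. *)
Lemma finite_value_minimax N p i v :
  (forall mu, exists nu, stage_sum p i mu nu (belief_value N p mu) <= v) ->
  finite_value N.+1 p i <= v.
Proof.
move=> reply; apply/ler_addgt0Pr => e e0.
pose e2 := e / 2; have e20 : 0 < e2 by rewrite divr_gt0.
pose Y := {y : dist R B * (A -> B -> S -> K -> R) |
            forall a b j, guaranteed N j (y.2 a b j)}.
pose F (y : Y) := vec_payoff i (sval y).1 (sval y).2.
pose f (y : Y) (g : {ffun K -> A}) := \sum_k p k * F y k (g k).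
have Fb y k a : 0 <= F y k a <= N.+1%:R * C by exact: vec_payoff_bounds (svalP y).
have [||y yP] := @approx_minimax R {ffun K -> A} Y [ffun=> point] f
    (N.+1%:R * C) (v + e2) _ _ e2 e20.
- move=> [[nu psi] g] [[nu' psi'] g'] t t01.
  have [nu'' [psi'' [g'' E]]] :=
    @vec_payoff_mix N i nu psi nu' psi' t t01 (@guaranteed_convex N) g g'.
  exists (exist _ (nu'', psi'') g'') => h.
  rewrite /f !mulr_sumr -big_split le_eqVlt; apply/orP; left; apply/eqP.
  by apply: eq_bigr => k _; rewrite /F/= E; ring.
- move=> l.
  (* Only the marginals of [l] matter: [f y g] is a sum over types [k] of terms depending on [g k]
     alone, so averaging over [l] gives the stage payoff of the behavioural strategy [mu]. *)
  have marg k : {m : dist R A | forall a, m a = \sum_(g : {ffun K -> A} | g k == a) l g}.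
    apply: dist_of => [a|]; first by apply: sumr_ge0 => g _; exact: Defs.pmf_ge0.
    by rewrite -(Defs.pmf_sum1 l) [RHS](partition_big (fun g : {ffun K -> A} => g k) xpredT).
  pose mu k := sval (marg k).
  have [nu nuv] := reply mu.
  (* The infimum defining the value need not be attained, so each continuation vector is taken
     within [e2] of it at the posterior. *)
  have /choice[psi psiP] (x : A * S) : exists psi, guaranteed N x.2 psi /\
      inner (posterior p0 mu x.1 p) psi <= finite_value N (posterior p0 mu x.1 p) x.2 + e2.
    have [psi g le] := finite_value_approx N (posterior p0 mu x.1 p) x.2 e20.
    by exists psi.
  pose psi' a (b : B) j := psi (a, j).
  have g a b j : guaranteed N j (psi' a b j) by exact: (psiP (a, j)).1.
  exists (exist _ (nu, psi') g); split.
    move=> h; have /andP[f0 f1] : 0 <= f (exist _ (nu, psi') g) h <= N.+1%:R * C.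
      by apply: inner_bounds => k; exact: Fb.
    by rewrite ger0_norm.
  rewrite (_ : \sum_h _ = stage_sum p i mu nu psi'); last first.
    rewrite stage_sumE /f; under eq_bigr do rewrite mulr_sumr.
    rewrite exchange_big; apply: eq_bigr => k _ /=.
    rewrite mulr_sumr (partition_big (fun g : {ffun K -> A} => g k) xpredT)//=.
    apply: eq_bigr => a _; rewrite (svalP (marg k)) mulr_suml mulr_sumr.
    by apply: eq_bigr => h /eqP <-; rewrite mulrCA.
  apply: (@le_trans _ _ (stage_sum p i mu nu (belief_value N p mu) + e2)).
    apply: stage_sum_mono; first exact: ltW.
    by move=> a b j; rewrite inner_cst; exact: (psiP (a, j)).2.
  by rewrite lerD2r.
(* The least vector that the plan [y] guarantees. The maximising actions form one of the maps from
   types to actions, at which the minimax bound is then read. *)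
pose phi k := F y k [arg max_(a > point) F y k a]%O.
have Fphi k a : F y k a <= phi k.
  by rewrite /phi; case: arg_maxP => // a' _ max; exact: max.
have g : guaranteed N.+1 i phi.
  split; first by move=> k; exact: Fb.
  by exists (sval y).1, (sval y).2; split; [exact: svalP y|exact: Fphi].
apply: (le_trans (finite_value_le p g)).
have := yP [ffun k => [arg max_(a > point) F y k a]%O].
rewrite /f -addrA -splitr; apply: le_trans.
by rewrite le_eqVlt; apply/orP; left; apply/eqP; apply: eq_bigr => k _; rewrite ffunE.
Qed.

(** Otherwise Player 2 could answer every [mu] with a payoff below the value minus [e], and
    [finite_value_minimax] would put the value below itself. *)
Lemma stage_optimal1 N p i (e : R) : 0 < e -> exists mu, forall nu,
  finite_value N.+1 p i - e <= stage_sum p i mu nu (belief_value N p mu).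
Proof.
move=> e0; apply: contrapT => H.
suff : finite_value N.+1 p i <= finite_value N.+1 p i - e by move=> ?; lra.
apply: finite_value_minimax => mu; apply: contrapT => H'; apply: H.
exists mu => nu; rewrite leNgt; apply/negP => /ltW lt; apply: H'; by exists nu.
Qed.

Lemma stage_optimal2 N p i (e : R) : 0 < e -> exists nu, forall mu,
  stage_sum p i mu nu (belief_value N p mu) <= finite_value N.+1 p i + e.
Proof.
move=> e0; have [phi [_ [nu [psi [g le]]]] phiE] := finite_value_approx N.+1 p i e0.
exists nu => mu; apply: le_trans phiE; exact: (stage_sum_guaranteed _ _ g le).
Qed.

(** Player 1 plays a nearly optimal stage action, then a nearly optimal policy for the posterior,
    each costing half of [e]. One policy must serve all initial states, because the continuation is
    chosen before the next state is drawn. *)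
Lemma finite_optimal1 N (p : dist R K) (e : R) : 0 < e -> exists pi, forall i sg,
  finite_value N p i - e <= \sum_k p k * type_payoff N k pi sg i.
Proof.
elim: N p e => [|N IH] p e e0.
  exists (fun _ _ _ => point_mass point) => i sg; rewrite finite_value0 sub0r.
  by rewrite big1 ?oppr_le0 ?ltW// => k _; rewrite mulr0.
have e20 : 0 < e / 2 by rewrite divr_gt0.
have /choice[mu muP] i := stage_optimal1 N p i e20.
have /choice[cont contP] p' := IH p' (e / 2) e20.
pose pi := glue1 (fun k i => mu i k)
  (fun x : S * A * B => cont (posterior p0 (mu x.1.1) x.1.2 p)).
exists pi => i sg; rewrite type_payoff_stage.
rewrite [e]splitr opprD addrA lerBlDr.
apply: (le_trans (muP i (sg 0 ([tuple], i)))); apply: stage_sum_mono; first exact: ltW.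
move=> a b j; rewrite inner_cst tail_glue1 -lerBlDr; exact: contP.
Qed.

(** Unrolls the witnesses in [guaranteed] into a policy. As in the previous optimality result, one
    policy serves all initial states; here it also works against every type and every policy of
    Player 1. *)
Lemma guaranteed_strategy N (phi : S -> K -> R) : (forall i, guaranteed N i (phi i)) ->
  exists sg, forall i k pi, type_payoff N k pi sg i <= phi i k.
Proof.
elim: N phi => [|N IH] phi g.
  exists (fun _ _ => point_mass point) => i k pi.
  by have /andP[] := guaranteed_bounds k (g i).
have /choice[nu /(_ _)/cid-/all_sig[psi psiP]] i := (g i).2.
have /choice[cont contP] (x : S * A * B) := IH (fun j => psi x.1.1 x.1.2 x.2 j)
  (fun j => (psiP x.1.1).1 x.1.2 x.2 j).
exists (glue2 nu cont) => i k pi /=.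
rewrite -[leRHS]mul1r -(Defs.pmf_sum1 (pi k 0 ([tuple], i))) mulr_suml.
apply: ler_sum => a _.
apply: (@le_trans _ _ (pi k 0 ([tuple], i) a * vec_payoff i (nu i) (psi i) k a)).
  rewrite mulr_sumr; apply: ler_sum => b _; rewrite -mulrA.
  rewrite ler_wpM2l ?Defs.pmf_ge0// ler_wpM2l ?Defs.pmf_ge0// lerD2l.
  apply: ler_sum => j _; rewrite ler_wpM2l// tail_glue2.
  exact: (contP (i, a, b)).
by rewrite ler_wpM2l ?Defs.pmf_ge0//; exact: (psiP i).2.
Qed.

Lemma finite_optimal2 N (p : dist R K) (e : R) : 0 < e -> exists sg, forall i pi,
  \sum_k p k * type_payoff N k pi sg i <= finite_value N p i + e.
Proof.
move=> e0; have /choice[phi phiP] i : exists phi, guaranteed N i phi /\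
    inner p phi <= finite_value N p i + e.
  by have [phi] := finite_value_approx N p i e0; exists phi.
have [sg sgP] := guaranteed_strategy (fun i => (phiP i).1).
exists sg => i pi; apply: le_trans (phiP i).2; apply: ler_sum => k _.
by rewrite ler_wpM2l ?Defs.pmf_ge0.
Qed.

End finite_game.

(** * Exponential weights and the layer-cake formula *)

Lemma measurable_sublevel (R : realType) d (T : measurableType d) (g : T -> R) s :
  measurable_fun setT g -> measurable [set x | g x <= s].
Proof.
move=> mg; rewrite (_ : mkset _ = g @^-1` `]-oo, s]%classic); last first.
  by apply/seteqP; split => z; rewrite /= in_itv/=.
by rewrite -[X in measurable X]setTI; apply: mg.
Qed.

Section exponential_weight.
Context {R : realType}.
Variable alpha : R.
Hypothesis alpha_gt0 : 0 < alpha.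
Notation leb := (@lebesgue_measure R).

Lemma measurable_discount : measurable_fun setT (fun s : R => expR (- alpha * s)).
Proof. by apply: measurableT_comp => //; exact: measurable_funM. Qed.

Let continuous_discount : continuous (fun s : R => expR (- alpha * s)).
Proof.
move=> z; apply: continuous_comp; last exact: continuous_expR.
by apply: continuousM => //; apply: (@continuousN _ R^o); exact: cst_continuous.
Qed.

Lemma integral_discount (a : R) :
  (\int[leb]_(s in `[a, +oo[) (alpha * expR (- alpha * s))%:E =
   (expR (- alpha * a))%:E)%E.
Proof.
rewrite (@ge0_continuous_FTC2y _ _ (fun x => - expR (- alpha * x)) _ 0)//.
- by rewrite EFinN oppeK add0e.
- by move=> x _; rewrite mulr_ge0 ?expR_ge0 ?ltW.
- apply: continuous_subspaceT => x.
  by apply: cvgM; [exact: cvg_cst|exact: continuous_discount].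
- rewrite -oppr0; apply: cvgN.
  rewrite (_ : (fun x => expR (- alpha * x)) =
               (fun z => expR (- z)) \o (fun z => alpha * z)); last first.
    by apply: eq_fun => x; rewrite mulNr.
  apply: (@cvg_comp _ _ _ _ _ _ (pinfty_nbhs R)); last exact: cvgr_expR.
  exact: gt0_cvgMry.
- by apply: cvgN; apply/cvg_at_right_filter; exact: continuous_discount.
- move=> z _; rewrite derive1_comp// derive1N// derive1_id mulN1r derive1_comp//.
  rewrite [X in _ * X]derive1E.
  rewrite derive1E; have /funeqP -> := @derive_expR R.
  by rewrite -derive1E derive1Ml// derive1_id mulr1 mulrN opprK mulrC.
Qed.

(* Integrates exp(-alpha g) = int_g^oo alpha exp(-alpha s) ds by Tonelli. *)
Lemma layer_cake d (T : measurableType d) (mu : {sigma_finite_measure set T -> \bar R})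
    (D : set T) (G g : T -> R) : measurable D ->
  measurable_fun setT G -> (forall x, 0 <= G x) -> measurable_fun setT g ->
  (\int[mu]_(x in D) (G x * expR (- alpha * g x))%:E =
   \int[leb]_s ((alpha * expR (- alpha * s))%:E *
                 \int[mu]_(x in D `&` [set x | (g x <= s)%R]) (G x)%:E))%E.
Proof.
move=> mD mG G0 mg.
pose E : set (T * R) := [set z | g z.1 <= z.2].
have mE : measurable E.
  rewrite (_ : E = (fun z : T * R => z.2 - g z.1) @^-1` `[0, +oo[%classic); last first.
    by apply/seteqP; split => z; rewrite /E/= in_itv/= andbT subr_ge0.
  rewrite -[X in measurable X]setTI; apply: measurable_funB => //.
  exact: measurableT_comp.
have mEs s : measurable [set x | g x <= s] by exact: measurable_sublevel.
pose f (z : T * R) : \bar R :=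
  (\1_D z.1 * G z.1 * (alpha * expR (- alpha * z.2)) * \1_E z)%:E.
have w0 s : 0 <= alpha * expR (- alpha * s) by rewrite mulr_ge0 ?expR_ge0 ?ltW.
have f0 z : (0 <= f z)%E.
  rewrite lee_fin /= !indicE; apply: mulr_ge0 => //; apply: mulr_ge0 => //.
  exact: mulr_ge0.
have mfst (h : T -> R) : measurable_fun setT h ->
    measurable_fun setT (fun z : T * R => h z.1).
  by move=> mh; exact: (measurableT_comp mh measurable_fst).
have mf : measurable_fun setT f.
  apply/measurable_EFinP; apply: measurable_funM; last exact: measurable_indic.
  apply: measurable_funM; first apply: measurable_funM.
  - by apply: mfst; exact: measurable_indic.
  - exact: mfst.
  - apply: measurable_funM => //.
    exact: (measurableT_comp measurable_discount measurable_snd).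
have itvE x s : (s \in (`[g x, +oo[%classic : set R)) = (g x <= s).
  by apply/idP/idP; rewrite inE/= in_itv/= andbT.
have EE x s : ((x, s) \in E) = (g x <= s) by apply/idP/idP; rewrite inE.
have leE x s : (x \in [set x | g x <= s]) = (g x <= s) by apply/idP/idP; rewrite inE.
transitivity (\int[mu]_x \int[leb]_s f (x, s))%E.
  rewrite integral_mkcond; apply: eq_integral => x _; rewrite patchE.
  have -> : (\int[leb]_s f (x, s) =
      (\1_D x * G x)%:E * \int[leb]_(s in `[g x, +oo[) (alpha * expR (- alpha * s))%:E)%E.
    rewrite [X in (_ * X)%E]integral_mkcond -ge0_integralZl//=.
    - apply: eq_integral => s _; rewrite patchE /f itvE !indicE EE/=.
      by case: ifP => _; rewrite ?mulr1 ?mulr0 ?mule0// EFinM.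
    - apply/(measurable_restrictT _ _).1 => //; apply/measurable_EFinP.
      by apply: measurable_funTS; apply: measurable_funM => //; exact: measurable_discount.
    - by move=> s _; rewrite patchE; case: ifP => _; rewrite ?lee_fin.
    - by rewrite lee_fin mulr_ge0.
  by rewrite integral_discount indicE -EFinM; case: ifP => _; rewrite ?mul1r ?mul0r.
have -> := @fubini_tonelli _ _ _ _ _ mu leb f mf f0.
apply: eq_integral => s _.
rewrite [in RHS]integral_mkcond -ge0_integralZl//=.
- apply: eq_integral => x _; rewrite patchE /f in_setI !indicE EE leE/=.
  case: (x \in D); case: (g x <= s) => /=; rewrite ?mulr1 ?mulr0 ?mul1r ?mul0r ?mule0//.
  by rewrite -EFinM mulrC.
- apply/(measurable_restrictT _ _).1; first exact: measurableI.
  by apply/measurable_EFinP; exact: measurable_funTS.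
- by move=> x _; rewrite patchE; case: ifP => _; rewrite ?lee_fin.
- by rewrite lee_fin.
Qed.

End exponential_weight.

(** * Stieltjes measures carried by the half line *)

Section cumulative_vanishing.
Context {R : realType}.
Variable F : cumulative R R.
Hypothesis F_ge0 : forall t, 0 <= F t.
Hypothesis F0 : F 0 = 0.

Let F_neg t : t <= 0 -> F t = 0.
Proof.
move=> t0; apply/eqP; rewrite eq_le F_ge0 andbT -F0.
exact: cumulative_is_nondecreasing.
Qed.

(** The measure is known on left-open intervals. Passing from []-1, s]] to [[0, s]] loses nothing,
    since the mass of []-1, 0[] is at most [F 0 - F (-1) = 0]. *)
Lemma stieltjes_half_line (s : R) :
  lebesgue_stieltjes_measure F (`[0, +oo[%classic `&` [set x : R | x <= s]) = (F s)%:E.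
Proof.
have ocE (a b : R) : a <= b ->
    lebesgue_stieltjes_measure F `]a, b]%classic = (F b - F a)%:E.
  move=> ab; rewrite /lebesgue_stieltjes_measure /measure_extension.
  by rewrite measurable_mu_extE/=; [rewrite wlength_itv_bnd|exact: is_ocitv].
have [s0|s0] := leP 0 s; last first.
  rewrite F_neg ?ltW// (_ : _ `&` _ = set0) ?measure0//.
  apply/seteqP; split => // x [/=]; rewrite in_itv/= andbT => x0 xs.
  by have := le_lt_trans (le_trans x0 xs) s0; rewrite ltxx.
have -> : `[0, +oo[%classic `&` [set x : R | x <= s] = `[0, s]%classic.
  apply/seteqP; split => x /=; rewrite !in_itv/= ?andbT.
    by move=> [-> ->].
  by move=> /andP[].
have m0 : lebesgue_stieltjes_measure F `]-1, 0[%classic = 0%E.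
  apply/eqP; rewrite eq_le measure_ge0 andbT.
  apply: (@le_trans _ _ (lebesgue_stieltjes_measure F `]-1, 0]%classic)).
    apply: le_measure; rewrite ?inE//; try exact: measurable_itv.
    by move=> x /=; rewrite !in_itv/= => /andP[-> /ltW].
  by rewrite ocE ?lerN10// F0 F_neg ?lerN10// subrr.
have := ocE (-1) s (le_trans (lerN10 R) s0).
rewrite (@F_neg (-1)) ?lerN10// subr0 => <-.
rewrite (_ : `]-1, s]%classic = `]-1, 0[%classic `|` `[0, s]%classic).
  rewrite measureU; try exact: measurable_itv; first by rewrite [X in X + _]m0 add0r.
  apply/seteqP; split => // x [/=]; rewrite !in_itv/= => /andP[_ x0] /andP[x0' _].
  by have := lt_le_trans x0 x0'; rewrite ltxx.
apply/seteqP; split => x /=; rewrite !in_itv/=.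
  by move=> /andP[-> ->]; rewrite andbT/=; case: ltP; [left|right].
move=> [/andP[-> /ltW x0]|/andP[x0 ->]]; first by rewrite (le_trans x0).
by rewrite andbT; lra.
Qed.

(** The layer-cake formula for the Stieltjes measure with density 1 and the identity as exponent. *)
Lemma laplace_stieltjes alpha : 0 < alpha ->
  (\int[lebesgue_stieltjes_measure F]_(t in `[0%R, +oo[) (expR (- alpha * t))%:E =
   \int[lebesgue_measure]_s ((alpha * expR (- alpha * s))%:E * (F s)%:E))%E.
Proof.
move=> alpha0.
have := @layer_cake R alpha alpha0 _ _ (lebesgue_stieltjes_measure F)
  `[0, +oo[%classic (cst 1) idfun (measurable_itv _) _ (fun=> ler01) _.
move=> /(_ _ _)/=; under eq_integral do rewrite mul1r.
move=> ->; [|exact: measurable_cst|exact: measurable_id].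
apply: eq_integral => s _; congr (_ * _)%E.
rewrite (integral_cst (lebesgue_stieltjes_measure F) _ 1%:E).
  by rewrite mul1e; exact: stieltjes_half_line.
apply: measurableI; first exact: measurable_itv.
rewrite (_ : mkset _ = `]-oo, s]%classic); first exact: measurable_itv.
by apply/seteqP; split => x; rewrite /= in_itv.
Qed.

End cumulative_vanishing.

(** * Laplace transforms of the semi-Markov kernel *)

Section sojourn.
Context {R : realType} {S A B : finPointedType}.
Variable Q : semi_markov_kernel R S A B.
Variable alpha : R.
Hypothesis alpha_gt0 : 0 < alpha.
Notation leb := (@lebesgue_measure R).

Definition laplace i a b j : R :=
  \int[lebesgue_stieltjes_measure (Q i a b j)]_(t in `[0%R, +oo[) expR (- alpha * t).

(** Since [1 - sojourn_df] is the survival function of the sojourn time, this is the expected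
    discounted length of a sojourn. *)
Definition hold i a b : R :=
  \int[leb]_(t in `[0%R, +oo[) (expR (- alpha * t) * (1 - sojourn_df Q t i a b)).

Let w s : R := alpha * expR (- alpha * s).

Let w_ge0 s : 0 <= w s.
Proof. by rewrite mulr_ge0 ?expR_ge0 ?ltW. Qed.

Let measurable_w : measurable_fun setT w.
Proof. by apply: measurable_funM => //; exact: measurable_discount. Qed.

Let measurable_wM (D : set R) (h : R -> R) : measurable_fun setT h ->
  measurable_fun D (fun s => (w s * h s)%:E).
Proof.
by move=> mh; apply/measurable_EFinP/measurable_funTS; exact: measurable_funM.
Qed.

Let measurable_Q i a b j : measurable_fun setT (Q i a b j).
Proof.
by apply: nondecreasing_measurable => //; exact: cumulative_is_nondecreasing.
Qed.

Let measurable_df i a b : measurable_fun setT (fun t => sojourn_df Q t i a b).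
Proof. by apply: measurable_sum => j; exact: measurable_Q. Qed.

Lemma smk_neg i a b j t : t <= 0 -> Q i a b j t = 0.
Proof.
move=> t0; apply/eqP; rewrite eq_le smk_ge0 andbT -(smk_at0 Q i a b j).
exact: cumulative_is_nondecreasing.
Qed.

Let integral_w0 : (\int[leb]_(s in `[0%R, +oo[) (w s)%:E = 1)%E.
Proof. by rewrite integral_discount// mulr0 expR0. Qed.

Let integral_w_le1 (h : R -> R) : measurable_fun setT h -> (forall s, 0 <= h s <= 1) ->
  (\int[leb]_(s in `[0%R, +oo[) (w s * h s)%:E <= 1)%E.
Proof.
move=> mh h01; rewrite -integral_w0; apply: ge0_le_integral => //=.
- by move=> s _; rewrite lee_fin mulr_ge0//; case/andP: (h01 s).
- exact: measurable_wM.
- by apply/measurable_EFinP/measurable_funTS; exact: measurable_w.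
- by move=> s _; rewrite lee_fin ler_piMr//; case/andP: (h01 s).
Qed.

Let Q01 i a b j t : 0 <= Q i a b j t <= 1.
Proof.
rewrite smk_ge0/=; apply: le_trans (smk_sum_le1 Q i a b t).
by rewrite (bigD1 j)//= lerDl; apply: sumr_ge0 => l _; exact: smk_ge0.
Qed.

Let df01 i a b t : 0 <= sojourn_df Q t i a b <= 1.
Proof. by rewrite smk_sum_le1 andbT; apply: sumr_ge0 => j _; exact: smk_ge0. Qed.

Lemma integral_discount_smk i a b j :
  (\int[leb]_s ((alpha * expR (- alpha * s))%:E * (Q i a b j s)%:E) =
   \int[leb]_(s in `[0%R, +oo[) (alpha * expR (- alpha * s) * Q i a b j s)%:E)%E.
Proof.
rewrite [RHS]integral_mkcond; apply: eq_integral => s _; rewrite patchE.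
have [_|/negP s0] := boolP (s \in _); first by rewrite EFinM.
rewrite -EFinM smk_neg ?mulr0// leNgt; apply/negP => /ltW s0'; apply: s0.
by rewrite inE/= in_itv/= s0'.
Qed.

(** [laplace] is a real-valued integral, which would read 0 if the extended one were infinite; the
    bound of the kernel by 1 gives finiteness. *)
Lemma laplaceE i a b j :
  (\int[leb]_s ((alpha * expR (- alpha * s))%:E * (Q i a b j s)%:E) =
   (laplace i a b j)%:E)%E.
Proof.
rewrite /laplace /Rintegral fineK; first by rewrite laplace_stieltjes//;
  [exact: smk_ge0|exact: smk_at0].
rewrite laplace_stieltjes//; [|exact: smk_ge0|exact: smk_at0].
rewrite integral_discount_smk ge0_fin_numE.
  exact: le_lt_trans (integral_w_le1 (measurable_Q _ _ _ _) (Q01 _ _ _ _)) (ltry _).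
by apply: integral_ge0 => s _; rewrite lee_fin; apply: mulr_ge0; [exact: w_ge0|exact: smk_ge0].
Qed.

Lemma laplace_ge0 i a b j : 0 <= laplace i a b j.
Proof. by apply: Rintegral_ge0 => t _; exact: expR_ge0. Qed.

Lemma sum_laplace i a b :
  (\int[leb]_(s in `[0%R, +oo[) (alpha * expR (- alpha * s) * sojourn_df Q s i a b)%:E =
  (\sum_j laplace i a b j)%:E)%E.
Proof.
rewrite -sumEFin; under [RHS]eq_bigr do rewrite -laplaceE integral_discount_smk.
rewrite -ge0_integral_sum//=.
- by apply: eq_integral => s _; rewrite sumEFin mulr_sumr.
- by move=> j; exact: measurable_wM.
- by move=> j s _; rewrite lee_fin; apply: mulr_ge0; [exact: w_ge0|exact: smk_ge0].
Qed.

Lemma sum_laplace_le1 i a b : \sum_j laplace i a b j <= 1.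
Proof. by rewrite -lee_fin -sum_laplace; exact: integral_w_le1. Qed.

(** The weight [alpha * expR (- alpha * s)] has mass 1 on the half line. Splitting 1 into
    [1 - sojourn_df] and [sojourn_df] splits that mass into the two terms. *)
Lemma holdE i a b : alpha * hold i a b = 1 - \sum_j laplace i a b j.
Proof.
set h := fun s => 1 - sojourn_df Q s i a b.
have h01 s : 0 <= h s <= 1 by have := df01 i a b s; rewrite /h; lra.
have mh : measurable_fun setT h by exact: measurable_funB.
have := integral_w0.
have -> : (\int[leb]_(s in `[0%R, +oo[) (w s)%:E =
   \int[leb]_(s in `[0%R, +oo[) (w s * h s)%:E +
   \int[leb]_(s in `[0%R, +oo[) (w s * sojourn_df Q s i a b)%:E)%E.
  rewrite -ge0_integralD//=.
  - by apply: eq_integral => s _; rewrite -EFinD /h; congr EFin; ring.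
  - by move=> s _; rewrite lee_fin mulr_ge0//; case/andP: (h01 s).
  - exact: measurable_wM.
  - by move=> s _; rewrite lee_fin mulr_ge0//; case/andP: (df01 i a b s).
  - exact: measurable_wM.
rewrite sum_laplace.
have -> : (\int[leb]_(s in `[0%R, +oo[) (w s * h s)%:E = (alpha * hold i a b)%:E)%E.
  have fin : (\int[leb]_(s in `[0%R, +oo[) (w s * h s)%:E)%E \is a fin_num.
    rewrite ge0_fin_numE; first exact: le_lt_trans (integral_w_le1 mh h01) (ltry _).
    by apply: integral_ge0 => s _; rewrite lee_fin mulr_ge0//; case/andP: (h01 s).
  have E : (\int[leb]_(s in `[0%R, +oo[) (w s * h s)%:E =
     alpha%:E * \int[leb]_(s in `[0%R, +oo[) (expR (- alpha * s) * h s)%:E)%E.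
    rewrite -ge0_integralZl//=.
    - by apply: eq_integral => s _; rewrite -EFinM mulrA.
    - apply/measurable_EFinP/measurable_funTS; apply: measurable_funM => //.
      exact: measurable_discount.
    - by move=> s _; rewrite lee_fin mulr_ge0 ?expR_ge0//; case/andP: (h01 s).
    - by rewrite lee_fin ltW.
  rewrite E EFinM; congr (_ * _)%E; rewrite /hold /Rintegral fineK//.
  rewrite E in fin; move: fin; rewrite !ge0_fin_numE.
  + move=> fin; rewrite ltey; apply/eqP => H; move: fin.
    by rewrite H gt0_muley ?lte_fin// ltxx.
  + by apply: integral_ge0 => s _; rewrite lee_fin mulr_ge0 ?expR_ge0//; case/andP: (h01 s).
  + apply: mule_ge0; first by rewrite lee_fin ltW.
    by apply: integral_ge0 => s _; rewrite lee_fin mulr_ge0 ?expR_ge0//; case/andP: (h01 s).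
by rewrite -EFinD => -[] <-; rewrite addrK.
Qed.

Lemma hold_ge0 i a b : 0 <= hold i a b.
Proof. by rewrite -(pmulr_rge0 _ alpha_gt0) holdE subr_ge0 sum_laplace_le1. Qed.

Lemma sum_laplace_lt1 delta eps : 0 < delta -> 0 < eps < 1 ->
  (forall i a b, sojourn_df Q delta i a b <= 1 - eps) ->
  exists2 rho, 0 < rho < 1 & forall i a b, \sum_j laplace i a b j <= rho.
Proof.
move=> delta0 /andP[eps0 eps1] Qdelta.
have ed1 : expR (- alpha * delta) < 1.
  by rewrite expR_lt1 mulNr oppr_lt0 mulr_gt0.
have ed0 := expR_gt0 (- alpha * delta).
(* The distribution function is at most [1 - eps] before [delta] and at most 1 afterwards; this is
   the integral of that bound against the weight of mass 1. *)
exists (1 - eps + eps * expR (- alpha * delta)); first by nra.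
move=> i a b; rewrite -lee_fin -sum_laplace.
pose h s := eps * \1_(`[delta, +oo[%classic : set R) s.
have mh : measurable_fun setT h.
  by apply: measurable_funM => //; apply: measurable_indic; exact: measurable_itv.
have h0 s : 0 <= h s by apply: mulr_ge0; [exact: ltW|rewrite indicE].
apply: (@le_trans _ _ (\int[leb]_(s in `[0%R, +oo[) ((w s * (1 - eps))%:E + (w s * h s)%:E))%E).
  apply: ge0_le_integral => //=.
  - by move=> s _; rewrite lee_fin; apply: mulr_ge0; [exact: w_ge0|case/andP: (df01 i a b s)].
  - exact: measurable_wM.
  - by apply: emeasurable_funD; exact: measurable_wM.
  - move=> s _; rewrite -EFinD lee_fin -mulrDr ler_wpM2l ?w_ge0// /h indicE.
    have [ds|sd] := boolP (s \in _).
      by rewrite mulr1 subrK; case/andP: (df01 i a b s).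
    rewrite mulr0 addr0; apply: le_trans (Qdelta i a b); apply: ler_sum => j _.
    apply: cumulative_is_nondecreasing; rewrite leNgt; apply/negP => /ltW ds.
    by move/negP: sd; apply; rewrite inE/= in_itv/= ds.
rewrite ge0_integralD//=; last 4 first.
- by move=> s _; rewrite lee_fin mulr_ge0// subr_ge0 ltW.
- exact: measurable_wM.
- by move=> s _; rewrite lee_fin mulr_ge0.
- exact: measurable_wM.
rewrite EFinD; apply: leeD.
  under eq_integral do rewrite EFinM.
  rewrite ge0_integralZr//= ?integral_w0 ?mul1e//.
  - by apply/measurable_EFinP/measurable_funTS; exact: measurable_w.
  - by move=> s _; rewrite lee_fin.
  - by rewrite lee_fin subr_ge0 ltW.
have -> : (\int[leb]_(s in `[0%R, +oo[) (w s * h s)%:E =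
    eps%:E * \int[leb]_(s in `[delta, +oo[) (w s)%:E)%E.
  rewrite [X in _ = (_ * X)%E]integral_mkcond [LHS]integral_mkcond -ge0_integralZl//=.
  - apply: eq_integral => s _; rewrite !patchE /h indicE.
    have [ds|sd] := boolP (s \in `[delta, +oo[%classic).
      rewrite ifT; first by rewrite mulr1 mulrC EFinM.
      by move: ds; rewrite !inE/= !in_itv/= !andbT; lra.
    by rewrite !mulr0 mule0; case: ifP.
  - apply/(measurable_restrictT _ _).1 => //.
    by apply/measurable_EFinP/measurable_funTS; exact: measurable_w.
  - by move=> s _; rewrite patchE; case: ifP => _; rewrite ?lee_fin.
  - by rewrite lee_fin ltW.
by rewrite integral_discount// EFinM.
Qed.

End sojourn.

(** * Comparing discounted integrals, and splitting integrals along fibers *)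

Section integration_tools.
Context {R : realType}.

(** Proportional masses of all sublevel sets give proportional exponential integrals. The two spaces
    may differ: the right-hand measure will be either the law or the Stieltjes measure of the
    kernel. *)
Lemma layer_cake_compare (alpha : R) d (T : measurableType d)
    (mu : {sigma_finite_measure set T -> \bar R}) (D : set T) (G g : T -> R)
    d' (T' : measurableType d') (mu' : {sigma_finite_measure set T' -> \bar R})
    (D' : set T') (G' g' : T' -> R) (y : R) : 0 < alpha -> 0 <= y ->
  measurable D -> measurable_fun setT G -> (forall x, 0 <= G x) -> measurable_fun setT g ->
  measurable D' -> measurable_fun setT G' -> (forall x, 0 <= G' x) -> measurable_fun setT g' ->
  (forall s, \int[mu]_(x in D `&` [set x | (g x <= s)%R]) (G x)%:E =
     y%:E * \int[mu']_(x in D' `&` [set x | (g' x <= s)%R]) (G' x)%:E)%E ->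
  (\int[mu]_(x in D) (G x * expR (- alpha * g x))%:E =
   y%:E * \int[mu']_(x in D') (G' x * expR (- alpha * g' x))%:E)%E.
Proof.
move=> a0 y0 mD mG G0 mg mD' mG' G0' mg' cmp.
have mle s : measurable [set x | g' x <= s] by exact: measurable_sublevel.
rewrite layer_cake//.
transitivity (\int[mu']_(x in D') (y * G' x * expR (- alpha * g' x))%:E)%E.
  rewrite layer_cake//; last 2 first.
  - exact: measurable_funM.
  - by move=> x; exact: mulr_ge0.
  apply: eq_integral => s _; rewrite cmp; congr (_ * _)%E.
  under [RHS]eq_integral do rewrite EFinM.
  rewrite ge0_integralZl//=.
  - exact: measurableI.
  - by apply/measurable_EFinP; exact: measurable_funTS.
  - by move=> x _; rewrite lee_fin.
under eq_integral do rewrite -mulrA EFinM.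
rewrite ge0_integralZl//=.
- apply/measurable_EFinP/measurable_funTS; apply: measurable_funM => //.
  exact: measurableT_comp (measurable_discount alpha) mg'.
- by move=> x _; rewrite lee_fin mulr_ge0 ?expR_ge0.
Qed.

Lemma integral_fibers d (T : measurableType d) (mu : {measure set T -> \bar R})
    (J : finType) (X : T -> J) (D : set T) (f : T -> \bar R) : measurable D ->
  (forall x, measurable [set w | X w = x]) -> measurable_fun D f ->
  (forall w, D w -> 0 <= f w)%E ->
  (\int[mu]_(w in D) f w = \sum_x \int[mu]_(w in D `&` [set w | X w = x]) f w)%E.
Proof.
move=> mD mX mf f0.
have DE : D = \big[setU/set0]_(x <- index_enum J) (D `&` [set w | X w = x]).
  rewrite -bigcup_seq; apply/seteqP; split => [w Dw|w [x _ []]//].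
  by exists (X w); rewrite //= mem_index_enum.
rewrite {1}DE ge0_integral_bigsetU//=.
- by move=> x; exact: measurableI.
- exact: index_enum_uniq.
- by move=> x y _ _ [w [[_ <-] [_ <-]]].
- by rewrite -DE.
- by move=> w; rewrite -DE; exact: f0.
Qed.

End integration_tools.

(** * Measurability of the coordinates of a path *)

Section path_space_measurability.
Context {R : realType} {K S A B : finPointedType}.
Notation Omega := (Omega R K S A B).

Let gen_subset (F : set (set path_space)) (U : set Omega) :
  F U -> F `<=` @coordinate_sets R K S A B -> measurable U.
Proof. by move=> FU sub; apply: sub_sigma_algebra; exact: sub. Qed.

Lemma gen_by_fiber (J : Type) (X : path_space -> J) (x : J) :
  gen_by X discrete_measurable [set w : @path_space R K S A B | X w = x].
Proof. by exists [set x] => //; apply/seteqP; split => [w []|w]. Qed.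

Lemma measurable_kappa k : measurable [set w : Omega | kappa w = k].
Proof. by apply: (gen_subset (gen_by_fiber kappa k)) => U ?; left. Qed.

Lemma measurable_state n i : measurable [set w : Omega | state n w = i].
Proof.
apply: (gen_subset (gen_by_fiber (state n) i)) => U ?; right; exists n => //.
by do 3 left.
Qed.

Lemma measurable_act1 n a : measurable [set w : Omega | act1 n w = a].
Proof.
apply: (gen_subset (gen_by_fiber (act1 n) a)) => U ?; right; exists n => //.
by left; left; right.
Qed.

Lemma measurable_act2 n b : measurable [set w : Omega | act2 n w = b].
Proof.
apply: (gen_subset (gen_by_fiber (act2 n) b)) => U ?; right; exists n => //.
by left; right.
Qed.

Lemma measurable_sojourn n : measurable_fun setT (sojourn n : Omega -> R).
Proof.
move=> _ Y mY; apply: (@gen_subset (gen_by (sojourn n) measurable)).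
  by exists Y.
by move=> U ?; right; exists n => //; right.
Qed.

Lemma measurable_jump_time n : measurable_fun setT (jump_time n : Omega -> R).
Proof. by apply: measurable_sum => m; exact: measurable_sojourn. Qed.

Lemma historyP n (w : Omega) (h : hist n) : history n w = h <->
  (forall m : 'I_n, (state m w, act1 m w, act2 m w) = tnth h.1 m) /\ state n w = h.2.
Proof.
case: h => t i; split => [[<- <-]|[/= tE iE]].
  by split => // m; rewrite tnth_mktuple.
by rewrite /history iE; congr pair; apply: eq_from_tnth => m; rewrite tnth_mktuple tE.
Qed.

Lemma measurable_history n (h : hist n) : measurable [set w : Omega | history n w = h].
Proof.
rewrite (_ : mkset _ = (\bigcap_(m in [set: 'I_n])
   ([set w | state m w = (tnth h.1 m).1.1] `&` [set w | act1 m w = (tnth h.1 m).1.2] `&`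
    [set w | act2 m w = (tnth h.1 m).2])) `&` [set w | state n w = h.2]); last first.
  apply/seteqP; split => w /=.
    by move=> /historyP[tE iE]; split => // m _; rewrite /= -tE.
  by move=> [tE iE]; apply/historyP; split => // m; have [[/= -> ->] ->] := tE m I;
    case: (tnth h.1 m) => -[].
apply: measurableI; last exact: measurable_state.
apply: fin_bigcap_measurable => // m _; apply: measurableI; last exact: measurable_act2.
by apply: measurableI; [exact: measurable_state|exact: measurable_act1].
Qed.

Lemma jump_timeS n (w : Omega) : jump_time n.+1 w = jump_time n w + sojourn n w.
Proof. by rewrite /jump_time big_ord_recr. Qed.

Lemma sojourn_ge0 n (w : Omega) : 0 <= sojourn n w.
Proof. by rewrite /sojourn. Qed.

Definition snoc_hist n (h : @hist S A B n) a b j : @hist S A B n.+1 :=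
  ([tuple of rcons h.1 (h.2, a, b)], j).

Lemma history_snoc n (w : Omega) (h : hist n) a b j :
  history n w = h -> act1 n w = a -> act2 n w = b -> state n.+1 w = j ->
  history n.+1 w = snoc_hist h a b j.
Proof.
move=> <- <- <- <-; congr pair; apply: val_inj => /=.
rewrite -[LHS]/(map _ _) enum_ordSr map_rcons -map_comp/=; congr rcons.
Qed.

End path_space_measurability.

(** * Discounted masses of histories under the law *)

Section law.
Context {R : realType} {K S A B : finPointedType}.
Notation Omega := (Omega R K S A B).
Variables (Q : semi_markov_kernel R S A B) (alpha : R).
Hypothesis alpha_gt0 : 0 < alpha.
Variables (p : dist R K) (i0 : S) (pi : policy1 R K S A B) (sg : policy2 R S A B).
Variable P : probability Omega R.
Hypothesis P_law : is_law Q p i0 pi sg P.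

Notation q := (laplace Q alpha).

Definition at_hist n k (h : hist n) : set Omega :=
  [set w | kappa w = k] `&` [set w | history n w = h].

Definition at_acts n k (h : hist n) a b : set Omega :=
  at_hist k h `&` [set w | act1 n w = a] `&` [set w | act2 n w = b].

Lemma measurable_at_hist n k (h : hist n) : measurable (at_hist k h).
Proof. by apply: measurableI; [exact: measurable_kappa|exact: measurable_history]. Qed.

Lemma measurable_at_acts n k (h : hist n) a b : measurable (at_acts k h a b).
Proof.
apply: measurableI; last exact: measurable_act2.
by apply: measurableI; [exact: measurable_at_hist|exact: measurable_act1].
Qed.

Definition discount n (w : Omega) : R := expR (- alpha * jump_time n w).

Lemma measurable_discount_time n (D : set Omega) : measurable_fun D (discount n).
Proof.
apply: measurable_funTS.
exact: measurableT_comp (measurable_discount alpha) (measurable_jump_time n).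
Qed.

Lemma jump_time_ge0 n (w : Omega) : 0 <= jump_time n w.
Proof. by apply: sumr_ge0 => m _; exact: sojourn_ge0. Qed.

Lemma discount_le1 n w : discount n w <= 1.
Proof.
by rewrite -expR0 ler_expR mulNr oppr_le0 mulr_ge0 ?jump_time_ge0 ?ltW.
Qed.

Lemma discountS n w : discount n.+1 w = discount n w * expR (- alpha * sojourn n w).
Proof. by rewrite /discount jump_timeS mulrDr expRD. Qed.

(** The weight that takes over from probability once the jump times are integrated out. *)
Definition disc n (D : set Omega) : R := fine (\int[P]_(w in D) (discount n w)%:E)%E.

Lemma discE n D : measurable D -> (\int[P]_(w in D) (discount n w)%:E = (disc n D)%:E)%E.
Proof.
move=> mD; rewrite fineK// ge0_fin_numE; last first.
  by apply: integral_ge0 => w _; rewrite lee_fin expR_ge0.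
apply: (@le_lt_trans _ _ (\int[P]_(w in D) (cst 1 w))%E); last first.
  by rewrite integral_cst// mul1e (le_lt_trans (probability_le1 _ mD))// ltry.
apply: ge0_le_integral => //.
- by move=> w _; rewrite lee_fin expR_ge0.
- by apply/measurable_EFinP; exact: measurable_discount_time.
- by move=> w _; rewrite lee_fin discount_le1.
Qed.

Lemma disc_ge0 n D : 0 <= disc n D.
Proof. by apply: fine_ge0; apply: integral_ge0 => w _; rewrite lee_fin expR_ge0. Qed.

(** The law speaks of events on which [jump_time n] is at most [s]; the layer-cake comparison turns
    their proportionality into that of expected discounts. *)
Let disc_scale n (D D' : set Omega) (y : R) : measurable D -> measurable D' -> 0 <= y ->
  (forall s : R, P (D `&` [set w | (jump_time n w <= s)%R]) =
     y%:E * P (D' `&` [set w | (jump_time n w <= s)%R]))%E ->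
  disc n D = y * disc n D'.
Proof.
move=> mD mD' y0 cmp.
have mT s := measurable_sublevel s (measurable_jump_time n).
apply: EFin_inj; rewrite EFinM -!discE//.
have E D0 : (\int[P]_(w in D0) (discount n w)%:E =
    \int[P]_(w in D0) (cst 1 w * expR (- alpha * jump_time n w))%:E)%E.
  by apply: eq_integral => w _; rewrite mul1r.
rewrite !E; apply: layer_cake_compare => // [||s]; try exact: measurable_jump_time.
rewrite (integral_cst P _ 1%:E); last exact: measurableI.
rewrite (integral_cst P _ 1%:E); last exact: measurableI.
by rewrite !mul1e; exact: cmp.
Qed.

Let gen_time n s : gen_by (@jump_time R K S A B n) measurable [set w | jump_time n w <= s].
Proof.
exists `]-oo, s]%classic; first exact: measurable_itv.
by apply/seteqP; split => w; rewrite /= in_itv/=; [move=> []|].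
Qed.

Let sigma_before_hist n k (h : hist n) s :
  @sigma_before R K S A B n (at_hist k h `&` [set w | jump_time n w <= s]).
Proof.
apply: (@measurableI _ (g_sigma_algebraType _)).
  apply: (@measurableI _ (g_sigma_algebraType _)); apply: sub_sigma_algebra; left.
    by left; exact: gen_by_fiber.
  by right; exact: gen_by_fiber.
by apply: sub_sigma_algebra; right; exact: gen_time.
Qed.

Let sigma_after_acts n k (h : hist n) a b s :
  @sigma_after R K S A B n (at_acts k h a b `&` [set w | jump_time n w <= s]).
Proof.
apply: (@measurableI _ (g_sigma_algebraType _)); last first.
  by apply: sub_sigma_algebra; left; left; right; exact: gen_time.
apply: (@measurableI _ (g_sigma_algebraType _)); last first.
  by apply: sub_sigma_algebra; right; exact: gen_by_fiber.
apply: (@measurableI _ (g_sigma_algebraType _)); last first.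
  by apply: sub_sigma_algebra; left; right; exact: gen_by_fiber.
apply: (@measurableI _ (g_sigma_algebraType _)); apply: sub_sigma_algebra.
  by left; left; left; left; exact: gen_by_fiber.
by left; left; left; right; exact: gen_by_fiber.
Qed.

(** Once the type and the history are fixed, the conditional probability of the actions is constant,
    whatever the bound on the jump time. *)
Lemma disc_acts n k (h : hist n) a b :
  disc n (at_acts k h a b) = pi k h a * sg h b * disc n (at_hist k h).
Proof.
apply: disc_scale.
- exact: measurable_at_acts.
- exact: measurable_at_hist.
- by rewrite mulr_ge0 ?Defs.pmf_ge0.
move=> s; have [_ /(_ _ (sigma_before_hist k h s)) E] := law_act P_law n a b.
rewrite (_ : at_acts k h a b `&` _ = at_hist k h `&` [set w | jump_time n w <= s] `&`
    [set w | act1 n w = a /\ act2 n w = b]); last first.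
  by apply/seteqP; split => w /=; rewrite /at_acts/=; tauto.
rewrite E -integral_cst; last first.
  apply: measurableI; first exact: measurable_at_hist.
  exact: measurable_sublevel _ (measurable_jump_time n).
by apply: eq_integral => w; rewrite inE => -[[/= -> ->] _].
Qed.

(** Intermediate stage of [disc_next]: [jump_time n] is integrated out with its discount, while the
    next sojourn is still only bounded by [s]. *)
Let disc_acts_le n k (h : hist n) a b j s :
  disc n (at_acts k h a b `&` [set w | state n.+1 w = j] `&` [set w | sojourn n w <= s]) =
  Q h.2 a b j s * disc n (at_acts k h a b).
Proof.
(* The law describes sojourns for nonnegative bounds only; for negative [s] both sides vanish. *)
have [s0|s0] := ltP s 0.
  rewrite smk_neg ?ltW// mul0r (_ : _ `&` _ = set0) /disc ?integral_set0//.
  apply/seteqP; split => // w [_ /=] ws.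
  by have := le_lt_trans (le_trans (sojourn_ge0 n w) ws) s0; rewrite ltxx.
have mA := measurable_at_acts k h a b.
apply: disc_scale => //.
- apply: measurableI; first by apply: measurableI => //; exact: measurable_state.
  exact: measurable_sublevel _ (measurable_sojourn n).
- exact: smk_ge0.
move=> s'; have [_ /(_ _ (sigma_after_acts k h a b s')) E] := law_jump P_law n j s0.
rewrite (_ : _ `&` _ `&` _ `&` _ = at_acts k h a b `&` [set w | jump_time n w <= s'] `&`
    [set w | jump_time n.+1 w - jump_time n w <= s /\ state n.+1 w = j]); last first.
  by apply/seteqP; split => w /=; rewrite jump_timeS [_ + sojourn _ _]addrC addrK; tauto.
rewrite E -integral_cst; last first.
  by apply: measurableI => //; exact: measurable_sublevel _ (measurable_jump_time n).
apply: eq_integral => w; rewrite inE => -[[[[/= _ wh] -> ] ->] _].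
by rewrite -wh.
Qed.

(** A second layer-cake comparison, in the sojourn time alone and with the discount at [jump_time n]
    as density; the masses of its sublevel sets match those of the Stieltjes measure of the
    kernel. *)
Lemma disc_next n k (h : hist n) a b j :
  disc n.+1 (at_acts k h a b `&` [set w | state n.+1 w = j]) =
  q h.2 a b j * disc n (at_acts k h a b).
Proof.
have mA := measurable_at_acts k h a b.
have mj : measurable (at_acts k h a b `&` [set w | state n.+1 w = j]).
  by apply: measurableI => //; exact: measurable_state.
apply: EFin_inj; rewrite -discE// mulrC EFinM.
under eq_integral do rewrite discountS.
transitivity ((disc n (at_acts k h a b))%:E *
    \int[lebesgue_stieltjes_measure (Q h.2 a b j)]_(x in `[0%R, +oo[)
       (cst 1 x * expR (- alpha * idfun x))%:E)%E; last first.
  congr (_ * _)%E; under eq_integral do rewrite /= mul1r.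
  by rewrite laplace_stieltjes ?laplaceE//; [exact: smk_ge0|exact: smk_at0].
apply: layer_cake_compare => //.
- exact: disc_ge0.
- exact: measurable_discount_time.
- by move=> w; exact: expR_ge0.
- exact: measurable_sojourn.
- exact: measurable_id.
move=> s; rewrite discE; last first.
  by apply: measurableI => //; exact: measurable_sublevel _ (measurable_sojourn n).
rewrite disc_acts_le (integral_cst (lebesgue_stieltjes_measure (Q h.2 a b j)) _ 1%:E).
  rewrite mul1e [X in (_ * X)%E](_ : _ = (Q h.2 a b j s)%:E) ?EFinM 1?muleC//.
  by apply: stieltjes_half_line; [exact: smk_ge0|exact: smk_at0].
apply: measurableI; first exact: measurable_itv.
rewrite (_ : mkset _ = `]-oo, s]%classic); first exact: measurable_itv.
by apply/seteqP; split => x; rewrite /= in_itv.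
Qed.

(** The law prescribes masses for the initial state [i0] only; they add up to 1, so every other
    initial state has probability 0. *)
Lemma init_state k i : P [set w | state 0 w = i /\ kappa w = k] =
  (if i == i0 then p k else 0)%:E.
Proof.
have [->|ii0] := eqVneq i i0; first exact: (law_init P_law).
have mS : measurable [set w : Omega | state 0 w = i0] by exact: measurable_state.
have P1 : P [set w | state 0 w = i0] = 1%E.
  rewrite -(mul1e (P _)) -integral_cst// (@integral_fibers _ _ _ P _ kappa)//; last first.
    by move=> k'; exact: measurable_kappa.
  rewrite -[RHS](congr1 EFin (Defs.pmf_sum1 p)) -sumEFin; apply: eq_bigr => k' _.
  rewrite integral_cst ?mul1e; first exact: (law_init P_law).
  by apply: measurableI => //; exact: measurable_kappa.
apply/eqP; rewrite eq_le measure_ge0 andbT.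
have PC : P (~` [set w | state 0 w = i0]) = 0%E by rewrite probability_setC// P1 subee.
rewrite -[leRHS]/(0%E) -PC.
apply: le_measure; rewrite ?inE.
- by apply: measurableI; [exact: measurable_state|exact: measurable_kappa].
- exact: measurableC.
- by move=> w [/= wi _] /= wi0; move/eqP: ii0; apply; rewrite -wi -wi0.
Qed.

End law.

Lemma measurable_fun_fibers (R : realType) d (T : measurableType d) (J : finType)
    (X : T -> J) (F : J -> R) (D : set T) :
  (forall x, measurable [set w | X w = x]) -> measurable_fun D (fun w => F (X w)).
Proof.
move=> mX; apply: measurable_funTS.
rewrite (_ : (fun w => F (X w)) = fun w => \sum_x F x * \1_[set w | X w = x] w).
  by apply: measurable_sum => x; apply: measurable_funM => //; exact: measurable_indic.
apply/funext => w; rewrite (bigD1 (X w))//= big1 ?addr0.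
  by rewrite indicE mem_set// mulr1.
by move=> x /eqP xX; rewrite indicE memNset ?mulr0//=; apply/nesym.
Qed.

(** * The finite-game payoff seen from the end of a history *)

Section remaining_payoff.
Context {R : realType} {K S A B : finPointedType}.
Variables (ct : K -> S -> A -> B -> R) (q : S -> A -> B -> S -> R).

(** The recursion of [type_payoff] with the policies kept fixed and the history growing at its end,
    the form that the law produces. *)
Fixpoint remaining N k (pi : policy1 R K S A B) (sg : policy2 R S A B) m (h : hist m) : R :=
  if N is N'.+1 then
    \sum_a \sum_b pi k m h a * sg m h b *
      (ct k h.2 a b + \sum_j q h.2 a b j * remaining N' k pi sg (snoc_hist h a b j))
  else 0.

Lemma snoc_cons_hist m x (h : @hist S A B m) a b j :
  snoc_hist (cons_hist x h) a b j = cons_hist x (snoc_hist h a b j).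
Proof. by congr pair; exact: val_inj. Qed.

Lemma remaining_cons N k pi sg x m (h : hist m) :
  remaining N k pi sg (cons_hist x h) = remaining N k (tail1 x pi) (tail2 x sg) h.
Proof.
elim: N m h => [|N IH] m h //=; apply: eq_bigr => a _; apply: eq_bigr => b _.
congr (_ * (_ + _)); apply: eq_bigr => j _.
by rewrite -IH -snoc_cons_hist.
Qed.

Lemma remaining_type_payoff N k pi sg i :
  remaining N k pi sg ([tuple], i) = type_payoff ct q N k pi sg i.
Proof.
elim: N pi sg i => [|N IH] pi sg i //=; apply: eq_bigr => a _; apply: eq_bigr => b _.
congr (_ * (_ + _)); apply: eq_bigr => j _; rewrite -IH -remaining_cons.
by congr (_ * remaining _ _ _ _ _); congr pair; exact: val_inj.
Qed.

End remaining_payoff.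

(** * Payoffs under the law as sums of stage rewards *)

Section law_payoff.
Context {R : realType} {K S A B : finPointedType}.
Notation Omega := (Omega R K S A B).
Variables (Q : semi_markov_kernel R S A B) (c : K -> S -> A -> B -> R) (alpha : R).
Hypothesis c_ge0 : forall k i a b, 0 <= c k i a b.
Hypothesis alpha_gt0 : 0 < alpha.
Variables (p : dist R K) (i0 : S) (pi : policy1 R K S A B) (sg : policy2 R S A B).
Variable P : probability Omega R.
Hypothesis P_law : is_law Q p i0 pi sg P.

Notation q := (laplace Q alpha).
Notation ct := (fun k i a b => c k i a b * hold Q alpha i a b).
Notation disc := (disc alpha P).
Notation discount := (@discount R K S A B alpha).

Lemma integral_at_hist n (f : Omega -> \bar R) : measurable_fun setT f ->
  (forall w, 0 <= f w)%E ->
  (\int[P]_w f w = \sum_k \sum_(h : hist n) \int[P]_(w in at_hist k h) f w)%E.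
Proof.
move=> mf f0; rewrite (@integral_fibers _ _ _ P _ kappa)//; last exact: measurable_kappa.
apply: eq_bigr => k _; rewrite setTI (@integral_fibers _ _ _ P _ (@history R K S A B n))//.
- exact: measurable_kappa.
- exact: measurable_history.
- exact: measurable_funTS.
Qed.

Lemma integral_at_acts n (f : Omega -> \bar R) : measurable_fun setT f ->
  (forall w, 0 <= f w)%E ->
  (\int[P]_w f w =
   \sum_k \sum_(h : hist n) \sum_a \sum_b \int[P]_(w in at_acts k h a b) f w)%E.
Proof.
move=> mf f0; rewrite (integral_at_hist n)//; apply: eq_bigr => k _; apply: eq_bigr => h _.
rewrite (@integral_fibers _ _ _ P _ (act1 n))//.
- apply: eq_bigr => a _; rewrite (@integral_fibers _ _ _ P _ (act2 n))//.
  + by apply: measurableI; [exact: measurable_at_hist|exact: measurable_act1].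
  + exact: measurable_act2.
  + exact: measurable_funTS.
- exact: measurable_at_hist.
- exact: measurable_act1.
- exact: measurable_funTS.
Qed.

Definition hist_weight n k (h : hist n) : R := disc n (at_hist k h).

Lemma hist_weight_ge0 n k (h : hist n) : 0 <= hist_weight k h.
Proof. exact: disc_ge0. Qed.

Let measurable_hist_fun n (F : K -> hist n -> R) (D : set Omega) :
  measurable_fun D (fun w => F (kappa w) (history n w)).
Proof.
apply: (@measurable_fun_fibers _ _ _ _ (fun w : Omega => (kappa w, history n w))
  (fun x => F x.1 x.2)) => -[k h].
rewrite (_ : mkset _ = at_hist k h); first exact: measurable_at_hist.
by apply/seteqP; split => w /=; [move=> [<- <-]|move=> [-> ->]].
Qed.

Let measurable_discounted n (F : K -> hist n -> R) (D : set Omega) :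
  measurable_fun D (fun w => (discount n w * F (kappa w) (history n w))%:E).
Proof.
apply/measurable_EFinP; apply: measurable_funM; first exact: measurable_discount_time.
exact: measurable_hist_fun.
Qed.

Lemma discount_sum n (F : K -> hist n -> R) : (forall k h, 0 <= F k h) ->
  (\int[P]_w (discount n w * F (kappa w) (history n w))%:E =
   (\sum_k \sum_h hist_weight k h * F k h)%:E)%E.
Proof.
move=> F0; rewrite (integral_at_hist n)//; last first.
  by move=> w; rewrite lee_fin mulr_ge0 ?expR_ge0.
rewrite -sumEFin; apply: eq_bigr => k _; rewrite -sumEFin; apply: eq_bigr => h _.
rewrite mulrC EFinM /hist_weight -(discE alpha_gt0); last exact: measurable_at_hist.
rewrite -ge0_integralZl//=.
- by apply: eq_integral => w; rewrite inE => -[/= -> ->]; rewrite mulrC EFinM.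
- exact: measurable_at_hist.
- by apply/measurable_EFinP; exact: measurable_discount_time.
- by move=> w _; rewrite lee_fin expR_ge0.
- by rewrite lee_fin.
Qed.

(** Pulls an expectation at stage [n.+1] back to the weights of stage [n], by [disc_next] and
    [disc_acts]. *)
Lemma discount_sumS n (F : K -> hist n.+1 -> R) : (forall k h, 0 <= F k h) ->
  (\int[P]_w (discount n.+1 w * F (kappa w) (history n.+1 w))%:E =
   (\sum_k \sum_(h : hist n) \sum_a \sum_b hist_weight k h * (pi k h a * sg h b *
     \sum_j q h.2 a b j * F k (snoc_hist h a b j)))%:E)%E.
Proof.
move=> F0; have f0 w : (0 <= (discount n.+1 w * F (kappa w) (history n.+1 w))%:E)%E.
  by rewrite lee_fin mulr_ge0 ?expR_ge0.
rewrite (integral_at_acts n)//.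
rewrite -sumEFin; apply: eq_bigr => k _; rewrite -sumEFin; apply: eq_bigr => h _.
rewrite -sumEFin; apply: eq_bigr => a _; rewrite -sumEFin; apply: eq_bigr => b _.
have mA := measurable_at_acts k h a b.
rewrite (@integral_fibers _ _ _ P _ (state n.+1))//; last exact: measurable_state.
rewrite mulr_sumr mulr_sumr -sumEFin; apply: eq_bigr => j _.
have mj : measurable (at_acts k h a b `&` [set w : Omega | state n.+1 w = j]).
  by apply: measurableI => //; exact: measurable_state.
rewrite (_ : hist_weight k h * _ = F k (snoc_hist h a b j) *
    disc n.+1 (at_acts k h a b `&` [set w : Omega | state n.+1 w = j])); last first.
  by rewrite (disc_next alpha_gt0 P_law) (disc_acts alpha_gt0 P_law) /hist_weight; ring.
rewrite EFinM -(discE alpha_gt0)// -ge0_integralZl//=.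
- apply: eq_integral => w; rewrite inE => -[[[[/= wk wh] wa] wb] wj].
  by rewrite (history_snoc wh wa wb wj) wk mulrC EFinM.
- by apply/measurable_EFinP; exact: measurable_discount_time.
- by move=> w _; rewrite lee_fin expR_ge0.
- by rewrite lee_fin.
Qed.

Definition reward n (w : Omega) : R :=
  alpha^-1 * (expR (- alpha * jump_time n w) - expR (- alpha * jump_time n.+1 w)) *
    c (kappa w) (state n w) (act1 n w) (act2 n w).

Lemma discount_nonincreasing n (w : Omega) : discount n.+1 w <= discount n w.
Proof.
by rewrite ler_expR !mulNr lerN2 ler_pM2l// jump_timeS lerDl; exact: sojourn_ge0.
Qed.

Lemma reward_ge0 n w : 0 <= reward n w.
Proof.
by rewrite mulr_ge0// mulr_ge0 ?invr_ge0 ?(ltW alpha_gt0)// subr_ge0 discount_nonincreasing.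
Qed.

Lemma measurable_reward n (D : set Omega) : measurable_fun D (reward n).
Proof.
apply: measurable_funM.
  apply: measurable_funM => //.
  by apply: measurable_funB; exact: measurable_discount_time.
apply: (@measurable_fun_fibers _ _ _ _
  (fun w : Omega => (kappa w, state n w, act1 n w, act2 n w))
  (fun x => c x.1.1.1 x.1.1.2 x.1.2 x.2)) => -[[[k i] a] b].
rewrite (_ : mkset _ = [set w | kappa w = k] `&` [set w | state n w = i] `&`
  [set w | act1 n w = a] `&` [set w | act2 n w = b]).
  apply: measurableI; last exact: measurable_act2.
  apply: measurableI; last exact: measurable_act1.
  by apply: measurableI; [exact: measurable_kappa|exact: measurable_state].
by apply/seteqP; split => w /=; [move=> [<- <- <- <-]|move=> [[[-> ->] ->] ->]].
Qed.

Definition stage_reward n : R := \sum_k \sum_(h : hist n) \sum_a \sum_b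
  hist_weight k h * (pi k h a * sg h b * ct k h.2 a b).

Let disc_actsS n k (h : hist n) a b : disc n.+1 (at_acts k h a b) =
  (\sum_j q h.2 a b j) * disc n (at_acts k h a b).
Proof.
have mA := measurable_at_acts k h a b.
apply: EFin_inj; rewrite -(discE alpha_gt0)// mulr_suml -sumEFin.
rewrite (@integral_fibers _ _ _ P _ (state n.+1))//.
- apply: eq_bigr => j _; rewrite -(disc_next alpha_gt0 P_law) -(discE alpha_gt0)//.
  by apply: measurableI => //; exact: measurable_state.
- exact: measurable_state.
- by apply/measurable_EFinP; exact: measurable_discount_time.
- by move=> w _; rewrite lee_fin expR_ge0.
Qed.

(** On each event fixing the actions, the expected drop of the discount is [1 - \sum_j q] times its
    value at stage [n]; [holdE] makes this factor [alpha * hold], which cancels [alpha^-1]. *)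
Lemma integral_reward n : (\int[P]_w (reward n w)%:E = (stage_reward n)%:E)%E.
Proof.
rewrite (integral_at_acts n); last 2 first.
- by apply/measurable_EFinP; exact: measurable_reward.
- by move=> w; rewrite lee_fin reward_ge0.
rewrite -sumEFin; apply: eq_bigr => k _; rewrite -sumEFin; apply: eq_bigr => h _.
rewrite -sumEFin; apply: eq_bigr => a _; rewrite -sumEFin; apply: eq_bigr => b _.
have mA := measurable_at_acts k h a b.
set D := at_acts k h a b in mA *.
have mdiff : measurable_fun D (fun w => (discount n w - discount n.+1 w)%:E).
  by apply/measurable_EFinP; apply: measurable_funB; exact: measurable_discount_time.
have diff0 w : (0 <= (discount n w - discount n.+1 w)%:E)%E.
  by rewrite lee_fin subr_ge0 discount_nonincreasing.
have diffE : (\int[P]_(w in D) (discount n w - discount n.+1 w)%:E =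
    (disc n D - disc n.+1 D)%:E)%E.
  have : (\int[P]_(w in D) (discount n w - discount n.+1 w)%:E + (disc n.+1 D)%:E =
      (disc n D)%:E)%E.
    rewrite -!(discE alpha_gt0)// -ge0_integralD//=.
    - by apply: eq_integral => w _; rewrite -EFinD subrK.
    - exact: mA.
    - by move=> w _; rewrite lee_fin expR_ge0.
    - by apply/measurable_EFinP; exact: measurable_discount_time.
  by rewrite EFinB => <-; rewrite addeK.
transitivity (\int[P]_(w in D) ((alpha^-1 * c k h.2 a b)%:E *
    (discount n w - discount n.+1 w)%:E))%E.
  apply: eq_integral => w; rewrite inE => -[[[/= wk wh] wa] wb].
  by rewrite /reward wk wa wb -wh -EFinM mulrAC.
rewrite ge0_integralZl//=; last 2 first.
- exact: mA.
- by rewrite lee_fin mulr_ge0// invr_ge0 ltW.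
rewrite diffE -EFinM; congr EFin.
rewrite disc_actsS (disc_acts alpha_gt0 P_law) -/(hist_weight k h).
have := holdE Q alpha_gt0 h.2 a b; set s := \sum_j _; set H := hold _ _ _ _ _ => HE.
have -> : s = 1 - alpha * H by rewrite HE; ring.
by field; rewrite gt_eqF.
Qed.

(** Induction on [N] for all [n]: the first remaining stage contributes [stage_reward n], and its
    continuation carries the weights to stage [n.+1]. *)
Let stageD N n : \sum_k \sum_(h : hist n) hist_weight k h * remaining ct q N k pi sg h =
  \sum_(l < N) stage_reward (n + l).
Proof.
have ct0 k i a b : 0 <= c k i a b * hold Q alpha i a b by rewrite mulr_ge0 ?hold_ge0.
have rem0 M k m (h : hist m) : 0 <= remaining ct q M k pi sg h.
  elim: M m h => [|M IH] m h //=; apply: sumr_ge0 => a _; apply: sumr_ge0 => b _.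
  rewrite mulr_ge0 ?mulr_ge0 ?Defs.pmf_ge0// addr_ge0//.
  by apply: sumr_ge0 => j _; rewrite mulr_ge0// laplace_ge0.
elim: N n => [|N IH] n.
  rewrite big_ord0 big1// => k _; rewrite big1// => h _; by rewrite mulr0.
rewrite big_ord_recl addn0.
under [in RHS]eq_bigr do rewrite /= /bump leq0n add1n -addSnnS.
rewrite -IH.
have -> : \sum_k \sum_(h : hist n.+1) hist_weight k h * remaining ct q N k pi sg h =
    \sum_k \sum_(h : hist n) \sum_a \sum_b hist_weight k h * (pi k h a * sg h b *
      \sum_j q h.2 a b j * remaining ct q N k pi sg (snoc_hist h a b j)).
  pose F k (h : hist n.+1) := remaining ct q N k pi sg h.
  have F0 k h : 0 <= F k h by exact: rem0.
  (* Both sides are one expectation at stage [n.+1], expanded over histories of length [n.+1] on the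
     left and of length [n] on the right. *)
  by apply: EFin_inj; rewrite -[RHS](discount_sumS F0) (discount_sum F0).
rewrite /stage_reward -big_split; apply: eq_bigr => k _; rewrite -big_split.
apply: eq_bigr => h _; rewrite -big_split/= mulr_sumr; apply: eq_bigr => a _.
rewrite -big_split/= mulr_sumr; apply: eq_bigr => b _; ring.
Qed.

Lemma hist_weight0 k (h : hist 0) : hist_weight k h = if h.2 == i0 then p k else 0.
Proof.
apply: EFin_inj; rewrite -(init_state P_law) /hist_weight -(discE alpha_gt0); last first.
  exact: measurable_at_hist.
rewrite (_ : at_hist k h = [set w | state 0 w = h.2 /\ kappa w = k]); last first.
  apply/seteqP; split => w /= [].
    by move=> wk wh; split => //; rewrite -wh.
  move=> wi wk; split => //; case: h wi => t i /= <-.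
  by congr pair; rewrite tuple0; exact/esym/tuple0.
transitivity (\int[P]_(w in [set w | state 0 w = h.2 /\ kappa w = k]) (cst 1 w))%E.
  by apply: eq_integral => w _; rewrite /discount /jump_time big_ord0 mulr0 expR0.
rewrite integral_cst ?mul1e//.
by apply: measurableI; [exact: measurable_state|exact: measurable_kappa].
Qed.

Lemma sum_stage N : \sum_(n < N) stage_reward n = \sum_k p k * type_payoff ct q N k pi sg i0.
Proof.
rewrite -(stageD N 0); apply: eq_bigr => k _.
rewrite (bigD1 ([tuple], i0))//= hist_weight0 (eqxx i0) remaining_type_payoff big1 ?addr0//.
move=> [t i] ti; rewrite hist_weight0/= ifF ?mul0r//; apply: contra_neqF ti => /eqP ->.
by congr pair; exact: tuple0.
Qed.

Lemma payoff_uptoE n :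
  payoff_upto c alpha P n = (\sum_k p k * type_payoff ct q n.+1 k pi sg i0)%:E.
Proof.
rewrite -sum_stage -sumEFin; apply: eq_bigr => m _.
by rewrite unlock -integral_reward.
Qed.

Lemma jump_time_nondecreasing (w : Omega) m n : (m <= n)%N ->
  jump_time m w <= jump_time n w.
Proof.
move=> /subnKC <-; elim: (n - m)%N => [|l IH]; first by rewrite addn0.
by rewrite addnS jump_timeS (le_trans IH)// lerDl sojourn_ge0.
Qed.

Lemma jump_index_eq (w : Omega) n t : jump_time n w <= t < jump_time n.+1 w ->
  jump_index t w = n.
Proof.
move=> tn; apply: xget_unique => //= m tm.
have lt_imp a b : jump_time a w <= t < jump_time a.+1 w ->
    jump_time b w <= t < jump_time b.+1 w -> (a <= b)%N.
  move=> /andP[ta _] /andP[_ tb]; rewrite leqNgt; apply/negP => ba.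
  by have := lt_le_trans tb (le_trans (jump_time_nondecreasing w ba) ta); rewrite ltxx.
by apply/eqP; rewrite eqn_leq !lt_imp.
Qed.

Lemma jump_intervals (w : Omega) :
  [set t : R | 0 <= t /\ (t%:E < jump_limit w)%E] =
  \bigcup_n `[jump_time n w, jump_time n.+1 w[%classic.
Proof.
have nd : {homo (fun n => (jump_time n w)%:E) : n m / (n <= m)%N >-> (n <= m)%E}.
  by move=> m n mn; rewrite lee_fin jump_time_nondecreasing.
have limE : jump_limit w = ereal_sup (range (fun n => (jump_time n w)%:E)).
  exact/cvg_lim/ereal_nondecreasing_cvgn.
apply/seteqP; split => t /=; rewrite limE.
  move=> [t0 /ereal_sup_gt[_ [n _ <-]]]; rewrite lte_fin => tn.
  have ex : exists n, t < jump_time n w by exists n.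
  (* The least index whose jump time exceeds [t] is positive because [jump_time 0] is 0, and its
     predecessor is the interval sought. *)
  case: (ex_minnP ex) => -[|m] tm min.
    by move: tm; rewrite /jump_time big_ord0 ltNge t0.
  exists m => //=; rewrite in_itv/= tm andbT leNgt; apply/negP => /min.
  by rewrite ltnn.
move=> [n _ /=]; rewrite in_itv/= => /andP[nt tn]; split.
  exact: le_trans (jump_time_ge0 n w) nt.
apply: (@lt_le_trans _ _ (jump_time n.+1 w)%:E); first by rewrite lte_fin.
by apply: ereal_sup_ubound; exists n.+1.
Qed.

Lemma integral_discount_itv (a b : R) : a <= b ->
  (\int[lebesgue_measure]_(t in `[a, b[) (expR (- alpha * t))%:E =
   (alpha^-1 * (expR (- alpha * a) - expR (- alpha * b)))%:E)%E.
Proof.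
move=> ab; have mw (D : set R) : measurable_fun D (fun t => (alpha * expR (- alpha * t))%:E).
  apply/measurable_EFinP/measurable_funTS; apply: measurable_funM => //.
  exact: measurable_discount.
have w0 (t : R) : (0 <= (alpha * expR (- alpha * t))%:E)%E.
  by rewrite lee_fin mulr_ge0 ?expR_ge0 ?(ltW alpha_gt0).
have Iab : (\int[lebesgue_measure]_(t in `[a, b[) (alpha * expR (- alpha * t))%:E =
    (expR (- alpha * a) - expR (- alpha * b))%:E)%E.
  have := integral_discount alpha_gt0 a.
  rewrite (@itv_bndbnd_setU _ _ (BLeft a) (BLeft b) +oo%O)//.
  rewrite ge0_integral_setU//=; last first.
    apply/disj_setPS => t [/=]; rewrite !in_itv/= andbT => /andP[_ tb] bt.
    by have := lt_le_trans tb bt; rewrite ltxx.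
    exact: mw.
  by rewrite integral_discount// EFinB => <-; rewrite addeK.
transitivity (\int[lebesgue_measure]_(t in `[a, b[)
    ((alpha^-1)%:E * (alpha * expR (- alpha * t))%:E))%E.
  by apply: eq_integral => t _; rewrite -EFinM mulKf// gt_eqF.
rewrite ge0_integralZl//=; [by rewrite Iab EFinM|exact: mw|].
by rewrite lee_fin invr_ge0 ltW.
Qed.

(** Between consecutive jumps the payoff rate is constant. The intervals are disjoint and exhaust
    the times before [jump_limit]; a zero sojourn gives an empty one. *)
Lemma path_payoff (w : Omega) :
  (\int[lebesgue_measure]_(t in [set t : R | (0 <= t)%R /\ t%:E < jump_limit w])
    (expR (- alpha * t) * c (kappa w) (state (jump_index t w) w)
       (act1 (jump_index t w) w) (act2 (jump_index t w) w))%:E =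
   \sum_(0 <= n <oo) (reward n w)%:E)%E.
Proof.
pose f (t : R) := (expR (- alpha * t) * c (kappa w) (state (jump_index t w) w)
       (act1 (jump_index t w) w) (act2 (jump_index t w) w))%:E.
have fE n t : (`[jump_time n w, jump_time n.+1 w[%classic : set R) t ->
    f t = ((c (kappa w) (state n w) (act1 n w) (act2 n w))%:E * (expR (- alpha * t))%:E)%E.
  by move=> /= tn; rewrite /f (@jump_index_eq w n)// -EFinM mulrC.
have mexp (D : set R) : measurable_fun D (fun t => (expR (- alpha * t))%:E).
  by apply/measurable_EFinP/measurable_funTS; exact: measurable_discount.
have mf n : measurable_fun `[jump_time n w, jump_time n.+1 w[%classic f.
  apply: (eq_measurable_fun (fun t =>
     (c (kappa w) (state n w) (act1 n w) (act2 n w))%:E * (expR (- alpha * t))%:E)%E).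
    by move=> t; rewrite inE => /fE ->.
  exact: measurable_funeM.
rewrite jump_intervals ge0_integral_bigcup//=; last 3 first.
- have mU := proj2 (measurable_fun_bigcup f
    (fun n => measurable_itv `[jump_time n w, jump_time n.+1 w[)).
  exact: mU mf.
- by move=> t _; rewrite lee_fin mulr_ge0 ?expR_ge0.
- move=> m n _ _ [t [/=]]; rewrite !in_itv/= => /(@jump_index_eq w m) <-.
  by move=> /(@jump_index_eq w n).
apply: eq_eseriesr => n _.
transitivity (\int[lebesgue_measure]_(t in `[jump_time n w, jump_time n.+1 w[)
   ((c (kappa w) (state n w) (act1 n w) (act2 n w))%:E * (expR (- alpha * t))%:E))%E.
  by apply: eq_integral => t; rewrite inE => /fE.
rewrite ge0_integralZl//=.
- by rewrite integral_discount_itv ?jump_time_nondecreasing// -EFinM mulrC.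
- exact: mexp.
- by rewrite lee_fin.
Qed.

Lemma payoffE : payoff c alpha P = (\sum_(0 <= n <oo) (stage_reward n)%:E)%E.
Proof.
rewrite /payoff; under eq_integral do rewrite path_payoff.
rewrite integral_nneseries//.
- by apply: eq_eseriesr => n _; exact: integral_reward.
- by move=> n; apply/measurable_EFinP; exact: measurable_reward.
- by move=> n w _; rewrite lee_fin reward_ge0.
Qed.

(** * Geometric decay of the discounted mass *)

Section geometric_tail.
Variables (C rho : R).
Hypothesis ct_le : forall k i a b, c k i a b * hold Q alpha i a b <= C.
Hypothesis rho01 : 0 < rho < 1.
Hypothesis q_le : forall i a b, \sum_j q i a b j <= rho.

(** The expectation of the discount at the [n]-th jump. *)
Let mass n : R := \sum_k \sum_(h : hist n) hist_weight k h.

Let acts_sum1 n k (h : hist n) : \sum_a \sum_b pi k h a * sg h b = 1.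
Proof.
under eq_bigr do rewrite -mulr_sumr Defs.pmf_sum1 mulr1.
exact: Defs.pmf_sum1.
Qed.

Let mass0 : mass 0 = 1.
Proof.
rewrite /mass -(Defs.pmf_sum1 p); apply: eq_bigr => k _.
rewrite (bigD1 ([tuple], i0))//= hist_weight0 (eqxx i0) big1 ?addr0//.
move=> [t i] ti; rewrite hist_weight0/= ifF//; apply: contra_neqF ti => /eqP ->.
by congr pair; exact: tuple0.
Qed.

Let massS n : mass n.+1 <= rho * mass n.
Proof.
pose F m (k : K) (h : @hist S A B m) : R := 1.
have one m k h : 0 <= F m k h by exact: ler01.
have E : mass n.+1 = \sum_k \sum_(h : hist n) \sum_a \sum_b hist_weight k h *
    (pi k h a * sg h b * \sum_j q h.2 a b j * 1).
  apply: EFin_inj; rewrite -[RHS](discount_sumS (one n.+1)) (discount_sum (one n.+1)).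
  by congr EFin; apply: eq_bigr => k _; apply: eq_bigr => h _; rewrite /F mulr1.
rewrite E /mass mulr_sumr; apply: ler_sum => k _.
rewrite mulr_sumr; apply: ler_sum => h _.
rewrite -[leRHS]mulr1 -[X in _ <= _ * X](acts_sum1 k h) mulr_sumr; apply: ler_sum => a _.
rewrite mulr_sumr; apply: ler_sum => b _.
rewrite [leRHS](_ : _ = hist_weight k h * (pi k h a * sg h b * rho)); last by ring.
rewrite ler_wpM2l ?hist_weight_ge0// ler_wpM2l ?mulr_ge0 ?Defs.pmf_ge0//.
by under eq_bigr do rewrite mulr1.
Qed.

Let mass_le n : mass n <= rho ^+ n.
Proof.
elim: n => [|n IH]; first by rewrite mass0 expr0.
by apply: le_trans (massS n) _; rewrite exprS ler_wpM2l//; case/andP: rho01 => /ltW.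
Qed.

Let C_ge0 : 0 <= C.
Proof.
by apply: le_trans (ct_le point point point point); rewrite mulr_ge0 ?hold_ge0.
Qed.

Let stage_le n : stage_reward n <= C * rho ^+ n.
Proof.
apply: (@le_trans _ _ (C * mass n)); last by rewrite ler_wpM2l.
rewrite /stage_reward /mass mulr_sumr; apply: ler_sum => k _.
rewrite mulr_sumr; apply: ler_sum => h _.
rewrite -[leRHS]mulr1 -[X in _ <= _ * X](acts_sum1 k h) mulr_sumr; apply: ler_sum => a _.
rewrite mulr_sumr; apply: ler_sum => b _.
rewrite [leRHS](_ : _ = hist_weight k h * (pi k h a * sg h b * C)); last by ring.
by rewrite ler_wpM2l ?hist_weight_ge0// ler_wpM2l ?mulr_ge0 ?Defs.pmf_ge0.
Qed.

Let stage_ge0 n : 0 <= stage_reward n.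
Proof.
by rewrite -lee_fin -integral_reward; apply: integral_ge0 => w _; rewrite lee_fin reward_ge0.
Qed.

(** Stage rewards are nonnegative and at most [C * rho ^+ n], so those from stage [N] on add a
    geometric tail. The bound does not depend on the policies. *)
Lemma payoff_bounds N :
  ((\sum_k p k * type_payoff ct q N k pi sg i0)%:E <= payoff c alpha P <=
   (\sum_k p k * type_payoff ct q N k pi sg i0 + C * rho ^+ N / (1 - rho))%:E)%E.
Proof.
have /andP[rho0 rho1] := rho01; have r1 : 0 < 1 - rho by rewrite subr_gt0.
rewrite payoffE -sum_stage; apply/andP; split.
  rewrite -sumEFin -(big_mkord xpredT (fun n => (stage_reward n)%:E)).
  by apply: nneseries_lim_ge => n _ _; rewrite lee_fin.
apply: lime_le; first by apply: is_cvg_nneseries => n _ _; rewrite lee_fin.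
exists N => // M /= NM; rewrite sumEFin lee_fin -(subnKC NM) big_mkord big_split_ord/=.
rewrite lerD2l; apply: (@le_trans _ _ (\sum_(l < M - N) C * rho ^+ N * rho ^+ l)).
  by apply: ler_sum => l _; rewrite -mulrA -exprD.
rewrite -mulr_sumr ler_wpM2l ?mulr_ge0 ?exprn_ge0 ?(ltW rho0)//.
rewrite -[leRHS]mul1r ler_pdivlMr//.
have -> : (\sum_(l < M - N) rho ^+ l) * (1 - rho) = 1 - rho ^+ (M - N).
  by rewrite -opprB mulrN mulrC -subrX1 opprB.
by rewrite gerBl exprn_ge0 ?ltW.
Qed.

End geometric_tail.

End law_payoff.

(** * Values from nearly optimal strategies *)

Section is_value_theory.
Context {R : realType} {X Y : Type}.
Implicit Types F : X -> Y -> \bar R.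

Lemma maxmin_le_minmax F : (maxmin F <= minmax F)%E.
Proof.
apply: ge_ereal_sup => _ [x _ <-]; apply: le_ereal_inf_tmp => _ [y _ <-].
apply: (@le_trans _ _ (F x y)).
  by apply: ereal_inf_lbound; exists y.
by apply: ereal_sup_ubound; exists x.
Qed.

(** The strategies place [v] below the maxmin and above the minmax, and weak duality closes the
    circle. *)
Lemma is_value_approx F (v : R) :
  (forall e : R, (0 < e)%R -> exists x, forall y, (v - e)%:E <= F x y)%E ->
  (forall e : R, (0 < e)%R -> exists y, forall x, F x y <= (v + e)%:E)%E ->
  is_value F v.
Proof.
move=> low up.
have low' : (v%:E <= maxmin F)%E.
  apply/lee_addgt0Pr => e e0; have [x xP] := low e e0.
  rewrite -leeBlDr// -EFinB.
  apply: (@le_trans _ _ (ereal_inf (range (fun y => F x y)))).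
    by apply: le_ereal_inf_tmp => _ [y _ <-].
  by apply: ereal_sup_ubound; exists x.
have up' : (minmax F <= v%:E)%E.
  apply/lee_addgt0Pr => e e0; have [y yP] := up e e0.
  rewrite -EFinD; apply: (@le_trans _ _ (ereal_sup (range (fun x => F x y)))).
    by apply: ereal_inf_lbound; exists y.
  by apply: ge_ereal_sup => _ [x _ <-].
have mm := maxmin_le_minmax F.
by split; apply/eqP; rewrite eq_le ?low' ?up' ?andbT; [exact: le_trans up'|exact: le_trans mm].
Qed.

Lemma valueE F (v : R) : is_value F v -> value F = v.
Proof.
move=> Fv; apply: xget_unique => // w Fw; apply: EFin_inj.
by rewrite -Fv.1 -Fw.1.
Qed.

End is_value_theory.

(** * Recursion for the finite-horizon values and passage to the limit *)

Theorem corollary3p8 (R : realType) (K S A B : finPointedType)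
    (Q : semi_markov_kernel R S A B)
    (c : K -> S -> A -> B -> R) (c_ge0 : forall k i a b, 0 <= c k i a b)
    (alpha : R) (alpha_gt0 : 0 < alpha)
    (p0 : dist R K)
    (P : dist R K -> S -> policy1 R K S A B -> policy2 R S A B ->
         probability (Omega R K S A B) R)
    (P_law : forall p i pi sigma, is_law Q p i pi sigma (P p i pi sigma)) :
  [/\ forall n p i, is_value (Vpay_upto c alpha P n p i)
                             (Vstar_upto c alpha P n p i),
      forall n p i,
        (Vstar_upto c alpha P n.+1 p i)%:E =
          shapley_up Q c alpha p0 (Vstar_upto c alpha P n) p i /\
        shapley_up Q c alpha p0 (Vstar_upto c alpha P n) p i =
          shapley_low Q c alpha p0 (Vstar_upto c alpha P n) p i,
      forall n p i,
        (Vstar_upto c alpha P n p i)%:E =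
          ereal_sup (range (fun mu => ereal_inf (range (fun nu =>
            (shapley_eval Q c alpha p0 (Vstar_before c alpha P n) p i mu nu)%:E))))
    & forall delta eps : R, 0 < delta -> 0 < eps < 1 ->
        (forall i a b, sojourn_df Q delta i a b <= 1 - eps) ->
        forall p i,
          is_value (Vpay c alpha P p i) (Vstar c alpha P p i) /\
          Vstar_upto c alpha P n p i @[n --> \oo] --> Vstar c alpha P p i].
Proof.
pose ct k i a b := c k i a b * hold Q alpha i a b.
pose q := laplace Q alpha.
have ct_ge0 k i a b : 0 <= ct k i a b by rewrite mulr_ge0// hold_ge0.
have [C ct_le] : exists C, forall k i a b, ct k i a b <= C.
  exists (\sum_(x : K * S * A * B) ct x.1.1.1 x.1.1.2 x.1.2 x.2) => k i a b.
  by rewrite (bigD1 (k, i, a, b))//= lerDl; apply: sumr_ge0.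
have q_ge0 i a b j : 0 <= q i a b j by exact: laplace_ge0.
have q_le1 i a b : \sum_j q i a b j <= 1 by exact: sum_laplace_le1.
pose val := finite_value ct q C.
have opt1 := finite_optimal1 p0 ct_ge0 ct_le q_ge0 q_le1.
have opt2 := finite_optimal2 ct_ge0 ct_le q_ge0 q_le1.
have uptoE n p i pi sg : Vpay_upto c alpha P n p i pi sg =
    (\sum_k p k * type_payoff ct q n.+1 k pi sg i)%:E.
  exact: (payoff_uptoE c_ge0 alpha_gt0 (P_law p i pi sg) n).
have upto_val n p i : is_value (Vpay_upto c alpha P n p i) (val n.+1 p i).
  apply: is_value_approx => e e0.
    have [pi piP] := opt1 n.+1 p e e0.
    by exists pi => sg; rewrite uptoE lee_fin piP.
  have [sg sgP] := opt2 n.+1 p e e0.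
  by exists sg => pi; rewrite uptoE lee_fin sgP.
have VE n : Vstar_upto c alpha P n = val n.+1.
  by apply/funext => p; apply/funext => i; exact: valueE.
have evalE u p i mu nu : shapley_eval Q c alpha p0 u p i mu nu =
    stage_sum ct q p i (mu^~ i) (nu i) (fun a b j k => u (posterior p0 (mu^~ i) a p) j).
  rewrite /shapley_eval -big_split; apply: eq_bigr => k _ /=.
  rewrite -big_split; apply: eq_bigr => a _ /=.
  rewrite -big_split; apply: eq_bigr => b _ /=.
  by rewrite mulrDr; congr (_ + _); rewrite -mulrA.
have shapley_val n p i : is_value
    (fun mu nu => (shapley_eval Q c alpha p0 (val n) p i mu nu)%:E) (val n.+1 p i).
  apply: is_value_approx => e e0.
    have [mu muP] := stage_optimal1 p0 ct_ge0 ct_le q_ge0 q_le1 n p i e0.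
    (* The operator at [(p, i)] reads the stage strategies at the state [i] only, so they may be
       constant in the state. *)
    by exists (fun k _ => mu k) => nu; rewrite lee_fin evalE muP.
  have [nu nuP] := stage_optimal2 p0 ct_ge0 ct_le q_ge0 q_le1 n p i e0.
  by exists (fun=> nu) => mu; rewrite lee_fin evalE nuP.
split.
- by move=> n p i; rewrite VE.
- move=> n p i; rewrite !VE /shapley_up /shapley_low.
  by have [-> ->] := shapley_val n.+1 p i.
- move=> n p i; rewrite VE -(shapley_val n p i).1.
  suff -> : Vstar_before c alpha P n = val n by [].
  (* At [n = 0] the convention of a zero value agrees with the value of the game without stages. *)
  case: n => [|n]; last exact: VE.
  by rewrite /val (finite_value0 ct_ge0 ct_le q_ge0 q_le1).
move=> delta eps delta0 eps01 Qdelta p i.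
have [rho rho01 q_le] := sum_laplace_lt1 alpha_gt0 delta0 eps01 Qdelta.
have bnd N pi sg := payoff_bounds c_ge0 alpha_gt0 (P_law p i pi sg) ct_le rho01 q_le N.
have /andP[rho0 rho1] := rho01.
pose err n := C * rho ^+ n / (1 - rho).
have err0 : err @ \oo --> (0 : R).
  have -> : 0 = (C * 0) / (1 - rho) :> R by rewrite mulr0 mul0r.
  apply: cvgMl; apply: cvgMr; apply: cvg_expr; by rewrite ger0_norm ?ltW.
have Vbnd n pi sg : ((\sum_k p k * type_payoff ct q n k pi sg i)%:E <=
    Vpay c alpha P p i pi sg <= (\sum_k p k * type_payoff ct q n k pi sg i + err n)%:E)%E.
  exact: bnd.
(* A nearly optimal policy of Player 1 for [m] stages is played against one of Player 2 for [n]
   stages; the infinite payoff of this pair lies between the two estimates. *)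
have val_le m n : val m p i <= val n p i + err n.
  apply/ler_addgt0Pr => e e0; have e20 : 0 < e / 2 by rewrite divr_gt0.
  have [pi /(_ i) piP] := opt1 m p _ e20; have [sg /(_ i) sgP] := opt2 n p _ e20.
  have /andP[le1 _] := Vbnd m pi sg; have /andP[_ le2] := Vbnd n pi sg.
  have := le_trans le1 le2; rewrite lee_fin.
  move: (piP sg) (sgP pi); rewrite -!/(val _ _ _); lra.
(* By [val_le] this supremum is finite and within [err n] of each [val n], hence it is the limit. *)
pose v := sup (range (fun n => val n p i)).
have vsup : has_sup (range (fun n => val n p i)).
  split; first by exists (val 0 p i), 0%N.
  by exists (val 0 p i + err 0%N) => _ [m _ <-].
have val_v n : val n p i <= v by apply: ub_le_sup; [exact: vsup.2|exists n].
have v_val n : v <= val n p i + err n.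
  by apply: ge_sup; [exact: vsup.1|move=> _ [m _ <-]].
(* Once [err n < e / 2], a policy of either player within [e / 2] of optimal for [n] stages
   guarantees [v] up to [e] in the infinite game. *)
have Vv : is_value (Vpay c alpha P p i) v.
  apply: is_value_approx => e e0; have e20 : 0 < e / 2 by rewrite divr_gt0.
    have [n _ /(_ n (leqnn n)) /= errn] := cvgr_lt 0 err0 _ e20.
    have [pi /(_ i) piP] := opt1 n p _ e20; exists pi => sg.
    have /andP[le1 _] := Vbnd n pi sg; apply: le_trans le1; rewrite lee_fin.
    move: (piP sg) (v_val n) errn; rewrite -!/(val _ _ _); lra.
  have [n _ /(_ n (leqnn n)) /= errn] := cvgr_lt 0 err0 _ e20.
  have [sg /(_ i) sgP] := opt2 n p _ e20; exists sg => pi.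
  have /andP[_ le2] := Vbnd n pi sg; apply: le_trans le2 _; rewrite lee_fin.
  move: (sgP pi) (val_v n) errn; rewrite -!/(val _ _ _); lra.
have VvE : Vstar c alpha P p i = v by exact: valueE.
split; first by rewrite VvE.
(* [Vstar_upto n] counts [n.+1] stages, so the error sequence is shifted by one. *)
rewrite VvE; apply/cvgrPdist_le => e e0; move: err0; rewrite -cvg_shiftS => err0.
have [N _ HN] := cvgr_lt 0 err0 _ e0; exists N => // n /HN /= errn.
rewrite VE ger0_norm; first by have := v_val n.+1; lra.
by rewrite subr_ge0.
Qed.
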